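(* Let $h,n\in\mathbb{N}^+$ and let $w\in W_n$ be a representative of $b\in B_n$. The problem of whether there exists an SCA representation $g\in S_n$ of $b$ of height $h$ is decidable.
   Context: **Braids.** $W_n$ is the set of finite words in the symbols $\sigma_1^{\pm1},\dots,\sigma_{n-1}^{\pm1}$ ($1$ is the empty word). The braid group $B_n$ is the quotient of $W_n$ by the relations $\sigma_i\sigma_i^{-1}=\sigma_i^{-1}\sigma_i=1$, $\sigma_i\sigma_j=\sigma_j\sigma_i$ for $|i-j|>1$, and $\sigma_i\sigma_{i+1}\sigma_i=\sigma_{i+1}\sigma_i\sigma_{i+1}$; $[w]$ is the class of $w$. **Cells.** A cell occupies two adjacent integer positions $(j,j+1)$ and is in one of eight states: $[N_j,N_{j+1}]$ (empty); $[s_j^{(i)},N_{j+1}]$, $[N_j,s_{j+1}^{(i)}]$, $[r_j^{(i)},N_{j+1}]$, $[N_j,l_{j+1}^{(i)}]$ (one strand); $[s_j^{(t)},s_{j+1}^{(t+1)}]$ (two straight strands); $[r_j^{(t)},l_{j+1}^{(t+1)}]$ (crossing of kind $T_1$, strand $t$ over strand $t+1$); $\overline{[r_j^{(t)},l_{j+1}^{(t+1)}]}$ (crossing of kind $T_2$, strand $t+1$ over strand $t$). Superscripts are strand numbers and the subscript is the position at which the strand enters. A strand marked $s$ (straight) leaves at the position where it enters, $r$ goes from $j$ to $j+1$, and $l$ goes from $j+1$ to $j$; strands marked $r$ or $l$ are said to turn. **Grid patterns.** An $n$-strand generation is a row of cells tiling the integer positions, all left positions having the same parity, containing exactly $n$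 strands numbered $1,\dots,n$ from left to right; it is written $C_0C_1\cdots C_w$, where $C_0$ contains strand $1$ and $C_w$ contains strand $n$ (all cells outside are empty). A grid pattern on $n$ strands is a finite or infinite list of $n$-strand generations (drawn upwards); $G_n$ is the set of these and $G_n^*$ the set of finite ones (including the empty list $[\,]$). The height of $g\in G_n^*$ is its number of generations. **Continuity and rules.** For adjacent cells $A$ at $(j,j+1)$, $B$ at $(j+2,j+3)$ of a generation, their child is the cell at $(j+1,j+2)$ of the next generation. $A$ sends a strand to the child if a strand leaves $A$ at $j+1$; $B$ does if a strand leaves $B$ at $j+2$. A grid pattern is continuous if the cells of each non-first generation are the children of adjacent pairs of the previous one and, for every adjacent pair $A,B$ (empty cells included) of a non-last generation, the left (right) position of the child is occupied iff $A$ (respectively $B$) sends a strand to it. A turning rule is a function $\tau:\{S,T,N\}^2\to\{S,T\}$ (the value at $(N,N)$ being irrelevant); it is a turning rule of a continuous pattern if for each adjacent pair $A,B$ with nonempty child the strands of the child are straight when $\tau(a,b)=S$ and all turn when $\tau(a,b)=T$, where $a$ (resp. $b$) is $N$, $S$ or $T$ according as $A$ (resp. $B$) sends no strand, a straight strand, or a turning strand to the child. A crossing rule is a function $\kappa:\{T_1,T_2,0\}^2\to\{T_1,T_2\}$; it is a crossing rule of the pattern if each child that is a crossing has kind $\kappa(a',b')$, where $a'$ (resp. $b'$) is the kind of crossing in $A$ (resp. $B$), or $0$ if there is none. An SCA pattern is a continuous grid pattern having at least one turning rule and at least one crossing rule; $S_n\subseteq G_n$ and $S_n^*\subseteq G_n^*$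 are the sets of SCA patterns. **Representations.** $\psi:G_n^*\to W_n$ reads the cells of $g$ generation by generation (first to last) and left to right within a generation, replacing $[r_j^{(t)},l_{j+1}^{(t+1)}]$ by $\sigma_t$, $\overline{[r_j^{(t)},l_{j+1}^{(t+1)}]}$ by $\sigma_t^{-1}$, and every other cell by the empty word; $\varphi(g)=[\psi(g)]\in B_n$. An SCA representation of $b\in B_n$ is a $g\in S_n^*$ with $\varphi(g)=b$. The decision problem takes as input $h$ and the word $w$. *)

(* Defs.v *)
From HB Require Import structures.
From mathcomp Require Import all_boot all_order all_algebra.
From mathcomp Require Import boolp.

Set Implicit Arguments.
Unset Strict Implicit.
Unset Printing Implicit Defensive.

(** * Recursive functions

    With classical axioms every predicate has a Boolean-valued characteristic
    function, so decidability has to refer to a model of computation.  [recursive]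
    is the class of total recursive functions: it contains the initial functions
    and is closed under composition, primitive recursion and minimization of
    regular functions. *)

Inductive recursive : forall k, (k.-tuple nat -> nat) -> Prop :=
| rec_zero k : recursive (fun _ : k.-tuple nat => 0)
| rec_succ : recursive (fun v : 1.-tuple nat => (tnth v ord0).+1)
| rec_proj k (i : 'I_k) : recursive (fun v : k.-tuple nat => tnth v i)
| rec_comp k m (f : m.-tuple nat -> nat) (g : 'I_m -> k.-tuple nat -> nat) :
    recursive f -> (forall i, recursive (g i)) ->
    recursive (fun v : k.-tuple nat => f [tuple g i v | i < m])
| rec_prim k (f : k.-tuple nat -> nat) (g : k.+2.-tuple nat -> nat) :
    recursive f -> recursive g ->
    recursive (fun v : k.+1.-tuple nat =>
      let u : k.-tuple nat := [tuple of behead v] in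
      iteri (thead v) (fun m r => g [tuple of m :: r :: u]) (f u))
| rec_min k (g : k.+1.-tuple nat -> nat)
    (g_regular : forall v : k.-tuple nat, exists m, g [tuple of m :: v] == 0) :
    recursive g -> recursive (fun v : k.-tuple nat => ex_minn (g_regular v))
| rec_ext k (f g : k.-tuple nat -> nat) :
    f =1 g -> recursive f -> recursive g.

(** [P] is a problem whose instances [x : T] are presented as [code x]. *)
Definition recursively_decidable (T : Type) (k : nat) (code : T -> k.-tuple nat)
    (P : T -> Prop) : Prop :=
  exists2 f : k.-tuple nat -> nat, recursive f &
    forall x : T, (P x -> f (code x) = 1) /\ (~ P x -> f (code x) = 0).

(** * Braids

    Indices and strand numbers are counted from 0: [(i, false)] stands for
    sigma_(i+1) and [(i, true)] for its inverse. *)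

Definition letter (n : nat) : Type := ('I_n.-1 * bool)%type.
HB.instance Definition _ n := Choice.on (letter n).

Definition word (n : nat) : Type := seq (letter n).
HB.instance Definition _ n := Choice.on (word n).

Definition sigma n (i : 'I_n.-1) : letter n := (i, false).
Definition sigma_inv n (i : 'I_n.-1) : letter n := (i, true).

Inductive braid_relation n : word n -> word n -> Prop :=
| braid_invr i : braid_relation [:: sigma i; sigma_inv i] [::]
| braid_invl i : braid_relation [:: sigma_inv i; sigma i] [::]
| braid_far (i j : 'I_n.-1) : (i.+1 < j) || (j.+1 < i) ->
    braid_relation [:: sigma i; sigma j] [:: sigma j; sigma i]
| braid_adj (i j : 'I_n.-1) : j = i.+1 :> nat ->
    braid_relation [:: sigma i; sigma j; sigma i] [:: sigma j; sigma i; sigma j].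

Inductive braid_eq n : word n -> word n -> Prop :=
| braid_eq_rel (x y u v : word n) :
    braid_relation u v -> braid_eq (x ++ u ++ y) (x ++ v ++ y)
| braid_eq_refl u : braid_eq u u
| braid_eq_sym u v : braid_eq u v -> braid_eq v u
| braid_eq_trans u v w : braid_eq u v -> braid_eq v w -> braid_eq u w.

Definition braid_eqb n : rel (word n) := fun u v => `[< braid_eq u v >].

Lemma braid_eqb_refl n : reflexive (@braid_eqb n).
Proof. by move=> u; apply/asboolP; exact: braid_eq_refl. Qed.

Lemma braid_eqb_sym n : symmetric (@braid_eqb n).
Proof. by move=> u v; apply/asboolP/asboolP; exact: braid_eq_sym. Qed.

Lemma braid_eqb_trans n : transitive (@braid_eqb n).
Proof.
by move=> v u w /asboolP uv /asboolP vw; apply/asboolP; exact: braid_eq_trans vw.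
Qed.

Canonical braid_equiv n :=
  EquivRel (@braid_eqb n) (@braid_eqb_refl n) (@braid_eqb_sym n)
           (@braid_eqb_trans n).

Definition braid (n : nat) : Type := {eq_quot (braid_equiv n)}%qT.

Definition braid_class n (w : word n) : braid n :=
  (\pi_({eq_quot (braid_equiv n)}) w)%qT.

Lemma braid_classP n (u v : word n) :
  braid_class u = braid_class v <-> braid_eq u v.
Proof.
by split=> [/eqmodP/asboolP | uv] //; apply/eqmodP/asboolP.
Qed.

(** * Cells *)

Inductive turn_mark := Straight | Turning.
Inductive crossing_kind := T1 | T2.

(** The eight states.  A two-strand cell carries the index of its left strand. *)
Inductive cell (n : nat) :=
| Empty                                       (* [N, N] *)
| StraightLeft of 'I_n                        (* [s, N] *)
| StraightRight of 'I_n                       (* [N, s] *)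
| TurnRight of 'I_n                           (* [r, N] *)
| TurnLeft of 'I_n                            (* [N, l] *)
| TwoStraight of 'I_n.-1                      (* [s, s] *)
| Crossing of crossing_kind & 'I_n.-1.        (* [r, l], without or with bar *)
Arguments Empty {n}.

Definition strands n (c : cell n) : seq nat :=
  match c with
  | Empty => [::]
  | StraightLeft i | StraightRight i | TurnRight i | TurnLeft i => [:: val i]
  | TwoStraight t | Crossing _ t => [:: val t; t.+1]
  end.

(** Occupation of the two positions of a cell by entering strands. *)
Definition enters_left n (c : cell n) : bool :=
  match c with
  | StraightLeft _ | TurnRight _ | TwoStraight _ | Crossing _ _ => true
  | _ => false
  end.

Definition enters_right n (c : cell n) : bool :=
  match c with
  | StraightRight _ | TurnLeft _ | TwoStraight _ | Crossing _ _ => true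
  | _ => false
  end.

(** The mark of the strand leaving at the left (right) position; [None] is N. *)
Definition leaves_left n (c : cell n) : option turn_mark :=
  match c with
  | StraightLeft _ | TwoStraight _ => Some Straight
  | TurnLeft _ | Crossing _ _ => Some Turning
  | _ => None
  end.

Definition leaves_right n (c : cell n) : option turn_mark :=
  match c with
  | StraightRight _ | TwoStraight _ => Some Straight
  | TurnRight _ | Crossing _ _ => Some Turning
  | _ => None
  end.

(** The common mark of the strands of a nonempty cell. *)
Definition cell_mark n (c : cell n) : option turn_mark :=
  match c with
  | Empty => None
  | StraightLeft _ | StraightRight _ | TwoStraight _ => Some Straight
  | TurnRight _ | TurnLeft _ | Crossing _ _ => Some Turning
  end.

Definition cell_crossing n (c : cell n) : option crossing_kind :=
  if c is Crossing k _ then Some k else None.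

(** * Grid patterns *)

(** The row [C_0 ... C_w], where [C_0] occupies positions (start, start + 1). *)
Record generation (n : nat) := Generation {
  start : int;
  cells : seq (cell n);
  _ : flatten (map (@strands n) cells) = iota 0 n;
  _ : 0 \in strands (head Empty cells);
  _ : n.-1 \in strands (last Empty cells)
}.

(** The cell with left position [j], which is meaningful when [j] has the
    parity of [start G]. *)
Definition cell_at n (G : generation n) (j : int) : cell n :=
  if (start G <= j)%R then nth Empty (cells G) (absz (j - start G)%R)./2
  else Empty.

Definition pattern (n : nat) : Type := seq (generation n).

Definition height n (g : pattern n) : nat := size g.

Definition consecutive n (g : pattern n) (G G' : generation n) : Prop :=
  exists g1 g2, g = g1 ++ [:: G, G' & g2].

(** [A] and [B] are adjacent in a non-last generation [G] of [g], and [C] is the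
    cell of the next generation at the position of their child. *)
Definition child_of n (g : pattern n) (A B C : cell n) : Prop :=
  exists (G G' : generation n) (j : int),
    [/\ consecutive g G G',
        (j = start G %[mod 2])%Z,
        A = cell_at G j,
        B = cell_at G (j + 2)%R
      & C = cell_at G' (j + 1)%R].

Definition continuous n (g : pattern n) : Prop :=
  (forall G G', consecutive g G G' -> (start G' = start G + 1 %[mod 2])%Z) /\
  (forall A B C, child_of g A B C ->
     (enters_left C <-> leaves_right A <> None) /\
     (enters_right C <-> leaves_left B <> None)).

Definition turning_rule n (g : pattern n)
    (tau : option turn_mark -> option turn_mark -> turn_mark) : Prop :=
  forall A B C, child_of g A B C -> C <> Empty ->
    cell_mark C = Some (tau (leaves_right A) (leaves_left B)).

Definition crossing_rule n (g : pattern n)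
    (kappa : option crossing_kind -> option crossing_kind -> crossing_kind) :
    Prop :=
  forall A B k t, child_of g A B (Crossing k t) ->
    k = kappa (cell_crossing A) (cell_crossing B).

Definition SCA_pattern n (g : pattern n) : Prop :=
  [/\ continuous g, exists tau, turning_rule g tau
    & exists kappa, crossing_rule g kappa].

(** * Representations *)

Definition cell_word n (c : cell n) : word n :=
  match c with
  | Crossing T1 t => [:: sigma t]
  | Crossing T2 t => [:: sigma_inv t]
  | _ => [::]
  end.

Definition pattern_word n (g : pattern n) : word n :=
  flatten [seq flatten (map (@cell_word n) (cells G)) | G <- g].

Definition pattern_braid n (g : pattern n) : braid n :=
  braid_class (pattern_word g).

Definition SCA_representation n (b : braid n) (g : pattern n) : Prop :=
  SCA_pattern g /\ pattern_braid g = b.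

(** * The decision problem *)

(** The instances are pairs of a positive height and a word; words are presented
    through the Goedel numbering [CodeSeq.code] of sequences of numbers. *)
Definition instance (n : nat) : Type := ({h : nat | 0 < h} * word n)%type.

Definition letter_code n (x : letter n) : nat := x.1.*2 + x.2.

Definition word_code n (w : word n) : nat :=
  CodeSeq.code (map (@letter_code n) w).

Definition instance_code n (x : instance n) : 2.-tuple nat :=
  [tuple sval x.1; word_code x.2].

Lemma instance_code_inj n : injective (@instance_code n).
Proof.
move=> [h w] [h' w'] /(congr1 val)[/val_inj -> /(can_inj CodeSeq.codeK) ww'].
congr pair; apply: inj_map ww' => -[i b] [j c]; rewrite /letter_code /= => ij.
have bc : b = c.
  by move: (congr1 odd ij); rewrite !oddD !odd_double !addFb !oddb.
by move: ij; rewrite bc => /addIn/double_inj/val_inj ->.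
Qed.

(* Main.v *)
Require Import Defs.
From HB Require Import structures.
From Stdlib Require Import Setoid Morphisms.
From mathcomp Require Import all_boot all_algebra zify.
From mathcomp Require Import boolp.

(** Two things make the problem decidable: for each height only finitely many
    patterns have to be examined, and the word problem of the braid group is
    solvable.

    Patterns.  Under fixed turning and crossing rules, a cell is determined by the
    two cells of which it is the child.  This includes its strand numbers, as a
    crossing exchanges two strands but not the two numbers ([child]).  A pattern
    of height [h] is thus given by its rules, of which there are finitely many, and
    its first row ([SCA_representationP]).  The first row may contain arbitrarily
    long gaps, but information travels by half a cell in each generation, so that
    a gap of [h] or more empty cells has the same effect as one of exactly [h]
    ([run_gap]).  Hence first rows of a size bounded in terms of [h] suffice
    ([short_row]).

    Word problem.  By a theorem of Garside, in the monoid of positive braids a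
    common multiple of two generators is a multiple of their least common multiple
    ([garside]); in particular the monoid is left cancellative.  The full twist is
    central in this monoid and a multiple of every generator, so that the
    braid group is obtained from the monoid by inverting the full twist alone.
    Clearing denominators turns the equality of two braids into the equivalence of
    two positive words ([braid_eqP]).  The relations between positive words preserve
    the length, so that an equivalence class is finite and can be exhausted
    ([peqbP]).

    Computability.  Sequences and pairs are coded by numbers in the manner of
    [CodeSeq.code].  The functions that are recursive on codes are closed under
    iteration, hence under recursion on sequences, and contain all functions with a
    finite domain; the decision procedure is composed from these.  The rules
    enter as a finite disjunction over the ways in which they can act on the cells
    for the given number of strands. *)

Set Implicit Arguments.
Unset Strict Implicit.
Unset Printing Implicit Defensive.

(** * Recursive functions of few arguments *)

Definition rec1 (F : nat -> nat) : Prop :=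
  recursive (fun v : 1.-tuple nat => F (tnth v ord0)).

Definition rec2 (F : nat -> nat -> nat) : Prop :=
  recursive (fun v : 2.-tuple nat => F (tnth v ord0) (tnth v (inord 1))).

Definition rec3 (F : nat -> nat -> nat -> nat) : Prop :=
  recursive (fun v : 3.-tuple nat =>
    F (tnth v ord0) (tnth v (inord 1)) (tnth v (inord 2))).

Lemma recursive_app1 k F (f : k.-tuple nat -> nat) :
  rec1 F -> recursive f -> recursive (fun v => F (f v)).
Proof.
move=> recF recf.
by apply: rec_ext (rec_comp recF (fun _ : 'I_1 => recf)) => v; rewrite tnth_mktuple.
Qed.

Lemma recursive_app2 k F (f g : k.-tuple nat -> nat) :
  rec2 F -> recursive f -> recursive g -> recursive (fun v => F (f v) (g v)).
Proof.
move=> recF recf recg.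
have recfg (i : 'I_2) : recursive (fun v => if i == 0 :> nat then f v else g v).
  by case: eqP.
apply: rec_ext (rec_comp recF recfg) => v.
by rewrite !tnth_mktuple inordK.
Qed.

Lemma rec2_iteri f G :
  rec1 f -> rec3 G ->
  rec2 (fun y x => iteri y (fun m r => G m r x) (f x)).
Proof.
move=> recf recG; apply: rec_ext (rec_prim recf recG) => v /=.
case/tupleP: v => y v; case/tupleP: v => x v; rewrite tuple0 /=.
have -> : tnth [tuple y; x] ord0 = y by [].
have -> : tnth [tuple y; x] (inord 1) = x by rewrite (tnth_nth 0) inordK.
rewrite theadE (_ : tnth _ ord0 = x); last by rewrite (tnth_nth 0).
apply: eq_iteri => m r.
by rewrite !(tnth_nth 0) !inordK.
Qed.

Lemma rec1_id : rec1 id.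
Proof. exact: rec_proj. Qed.

Lemma rec_succn k (f : k.-tuple nat -> nat) :
  recursive f -> recursive (fun v => (f v).+1).
Proof. exact: (@recursive_app1 k S f rec_succ). Qed.

Lemma rec_const k c : recursive (fun _ : k.-tuple nat => c).
Proof. by elim: c => [|c IHc]; [exact: rec_zero | exact: rec_succn]. Qed.

Arguments rec_const {k}.

Lemma rec1_iteri t f G :
  rec1 t -> rec1 f -> rec3 G ->
  rec1 (fun x => iteri (t x) (fun m r => G m r x) (f x)).
Proof.
move=> rect recf recG.
exact: recursive_app2 (rec2_iteri recf recG) rect rec1_id.
Qed.

Lemma rec1_if0 t f g :
  rec1 t -> rec1 f -> rec1 g -> rec1 (fun x => if t x == 0 then f x else g x).
Proof.
move=> rect recf recg.
have rect' : rec1 (fun x => iteri (t x) (fun _ _ => 0) 1).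
  apply: (rec1_iteri (f := fun _ => 1) (G := fun _ _ _ => 0)) => //.
    exact: rec_const.
  exact: rec_const.
have rec_it := rec1_iteri (G := fun _ _ x => f x) rect' recg
  (recursive_app1 recf (rec_proj _)).
apply: rec_ext rec_it => v.
by case: (t _).
Qed.

Lemma rec2_addn : rec2 addn.
Proof.
have rec_it := rec2_iteri (G := fun _ r _ => r.+1) rec1_id (rec_succn (rec_proj _)).
apply: rec_ext rec_it => v.
by elim: (tnth v ord0) => //= m ->.
Qed.

Lemma rec1_predn : rec1 predn.
Proof.
have rec_it := rec1_iteri (f := fun _ => 0) (G := fun m _ _ => m)
  rec1_id (rec_const 0) (rec_proj _).
by apply: rec_ext rec_it => v; case: (tnth v ord0).
Qed.

Lemma rec2_subn : rec2 subn.
Proof.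
have recG : rec3 (fun _ r _ => r.-1) := recursive_app1 rec1_predn (rec_proj _).
have rec_it : rec2 (fun y x => iteri y (fun _ r => r.-1) x) :=
  rec2_iteri rec1_id recG.
have rec_sub : recursive (fun v : 2.-tuple nat =>
    iteri (tnth v (inord 1)) (fun _ r => r.-1) (tnth v ord0)).
  exact: recursive_app2 rec_it (rec_proj _) (rec_proj _).
apply: rec_ext rec_sub => v.
elim: (tnth v (inord 1)) => [|m /= ->]; first by rewrite subn0.
by rewrite subnS.
Qed.

Lemma rec1_odd : rec1 odd.
Proof.
have recG : rec3 (fun _ r _ => 1 - r) :=
  recursive_app2 rec2_subn (rec_const 1) (rec_proj _).
have rec_it := rec1_iteri (f := fun _ => 0) rec1_id (rec_const 0) recG.
apply: rec_ext rec_it => v.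
by elim: (tnth v ord0) => //= m ->; case: odd.
Qed.

Lemma rec1_half : rec1 half.
Proof.
have recG : rec3 (fun m r _ => r + odd m) :=
  recursive_app2 rec2_addn (rec_proj _) (recursive_app1 rec1_odd (rec_proj _)).
have rec_it := rec1_iteri (f := fun _ => 0) rec1_id (rec_const 0) recG.
apply: rec_ext rec_it => v.
by elim: (tnth v ord0) => //= m ->; rewrite uphalf_half addnC.
Qed.

Lemma rec1_double : rec1 double.
Proof.
apply: rec_ext (recursive_app2 rec2_addn rec1_id rec1_id) => v.
by rewrite /= addnn.
Qed.

(** The code of the sequence [a :: s] is the pairing of [a] and the code of [s],
    so that one pairing function serves both products and sequences. *)
Definition code_pair a b := 2 ^ a * b.*2.+1.

Lemma rec2_code_pair : rec2 code_pair.
Proof.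
have recG : rec3 (fun _ r _ => r.*2) := recursive_app1 rec1_double (rec_proj _).
have recf : rec1 (fun b => b.*2.+1) := rec_succn rec1_double.
apply: rec_ext (rec2_iteri recf recG) => v; rewrite /code_pair.
elim: (tnth v ord0) => [|a /= ->]; first by rewrite mul1n.
by rewrite expnS -mulnA mul2n.
Qed.

Lemma iter_half_pow a m b : iter m half (2 ^ (m + a) * b) = 2 ^ a * b.
Proof.
elim: m => // m IHm; rewrite iterSr addSn expnS -mulnA mul2n doubleK.
exact: IHm.
Qed.

Lemma rec2_iter_half : rec2 (fun m c => iter m half c).
Proof.
exact: (rec2_iteri (f := id) (G := fun _ r _ => r./2) rec1_id
          (recursive_app1 rec1_half (rec_proj _))).
Qed.

(** Regularity of the minimization that computes the first component of a code. *)
Lemma odd_iter_half c : 0 < c -> exists m, odd (iter m half c).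
Proof.
elim/ltn_ind: c => c IHc c_gt0.
have [odd_c | even_c] := boolP (odd c); first by exists 0.
have [||m odd_m] := IHc c./2; [lia | lia |].
by exists m.+1; rewrite iterSr.
Qed.

(** The first component is the 2-adic valuation of the code: the least number of
    halvings that lead to an odd number. *)
Lemma rec1_code_fst : exists2 F, rec1 F & forall a b, F (code_pair a b) = a.
Proof.
(* The term [1 - c] makes the minimization regular at [c = 0], which no pair has
   as its code. *)
pose g m c := (1 - odd (iter m half c)) - (1 - c).
have recg : rec2 g.
  apply: (recursive_app2 rec2_subn).
    apply: (recursive_app2 rec2_subn); first exact: rec_const.
    exact: recursive_app1 rec1_odd rec2_iter_half.
  by apply: (recursive_app2 rec2_subn); [exact: rec_const | exact: rec_proj].
pose gv (u : 2.-tuple nat) := g (tnth u ord0) (tnth u (inord 1)).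
have gvE m (v : 1.-tuple nat) : gv [tuple of m :: v] = g m (tnth v ord0).
  by rewrite /gv !(tnth_nth 0) inordK.
have g_regular (v : 1.-tuple nat) : exists m, gv [tuple of m :: v] == 0.
  case c_eq: (tnth v ord0) => [|c]; first by exists 0; rewrite gvE c_eq.
  have [m odd_m] := odd_iter_half (ltn0Sn c).
  by exists m; rewrite gvE c_eq /g odd_m.
have recm := rec_min g_regular recg.
exists (fun c => ex_minn (g_regular [tuple c])).
  apply: rec_ext recm => v; case/tupleP: v => c v; rewrite tuple0 /=.
  by congr ex_minn; congr g_regular; apply: val_inj.
move=> a b; case: ex_minnP => m; rewrite gvE (tnth_nth 0) /= => g_m min_m.
have code_gt0 : 0 < code_pair a b by rewrite muln_gt0 expn_gt0.
have odd_iter k : (gv [tuple of k :: [tuple code_pair a b]] == 0)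
    = odd (iter k half (code_pair a b)).
  rewrite gvE (tnth_nth 0) /= /g.
  by case: odd; case: (code_pair a b) code_gt0.
apply/eqP; rewrite eqn_leq; apply/andP; split.
  apply: min_m; rewrite odd_iter /code_pair -[a in 2 ^ a]addn0 iter_half_pow.
  by rewrite mul1n /= odd_double.
rewrite leqNgt; apply/negP => lt_ma.
move: (odd_iter m); rewrite gvE (tnth_nth 0) /= g_m.
by rewrite /code_pair -(subnKC lt_ma) addSnnS iter_half_pow expnS -mulnA oddM.
Qed.

Lemma rec1_code_snd : exists2 F, rec1 F & forall a b, F (code_pair a b) = b.
Proof.
have [f recf fE] := rec1_code_fst.
exists (fun c => (iter (f c) half c)./2) => [|a b].
  exact: recursive_app1 rec1_half (recursive_app2 rec2_iter_half recf rec1_id).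
by rewrite fE /code_pair -[a in 2 ^ a]addn0 iter_half_pow mul1n /= uphalf_double.
Qed.

Lemma code_pair_inj a b a' b' : code_pair a b = code_pair a' b' -> a = a' /\ b = b'.
Proof.
have [f _ fE] := rec1_code_fst; have [g _ gE] := rec1_code_snd.
move=> eq_code; split; first by rewrite -(fE a b) eq_code fE.
by rewrite -(gE a b) eq_code gE.
Qed.

Lemma code_pair_gt b a : b < code_pair a b.
Proof.
have: 0 < 2 ^ a by rewrite expn_gt0.
rewrite /code_pair; nia.
Qed.

(** * Computable functions between coded types *)

HB.mixin Record isCoded T := { enc : T -> nat; enc_inj : injective enc }.

#[short(type="codedType")]
HB.structure Definition Coded := { T of Equality T & isCoded T }.

HB.instance Definition _ := isCoded.Build nat (@inj_id nat).

Lemma nat_of_bool_inj : injective nat_of_bool.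
Proof. by case=> -[]. Qed.
HB.instance Definition _ := isCoded.Build bool nat_of_bool_inj.

Section CodedProdSeq.
Variables A B : codedType.

Definition pair_enc (p : A * B) := code_pair (enc p.1) (enc p.2).

Lemma pair_enc_inj : injective pair_enc.
Proof. by move=> [a b] [c d] /code_pair_inj[/enc_inj/= -> /enc_inj/= ->]. Qed.
HB.instance Definition _ := isCoded.Build (A * B)%type pair_enc_inj.

Definition seq_enc (s : seq A) := CodeSeq.code (map enc s).

Lemma seq_enc_inj : injective seq_enc.
Proof. exact: inj_comp (can_inj CodeSeq.codeK) (inj_map enc_inj). Qed.
HB.instance Definition _ := isCoded.Build (seq A) seq_enc_inj.

End CodedProdSeq.

(** The type [A] is a context: the closure properties below are stated for
    functions of [a : A], which replaces the treatment of several variables. *)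
Definition computable (A B : codedType) (f : A -> B) : Prop :=
  exists2 F, rec1 F & forall a, F (enc a) = enc (f a).

Section ComputableBasics.
Implicit Types A B C T : codedType.

Lemma computable_ext A B (f g : A -> B) : f =1 g -> computable f -> computable g.
Proof. by move=> fg [F recF FE]; exists F => // a; rewrite FE fg. Qed.

Lemma computable_id A : computable (@id A).
Proof. by exists id => //; exact: rec1_id. Qed.

Lemma computable_const A B (b : B) : computable (fun _ : A => b).
Proof. by exists (fun _ => enc b) => //; exact: rec_const. Qed.

Lemma computable_comp A B C (g : B -> C) (f : A -> B) :
  computable g -> computable f -> computable (fun a => g (f a)).
Proof.
move=> [G recG GE] [F recF FE]; exists (fun x => G (F x)).
  exact: recursive_app1 recG recF.
by move=> a; rewrite FE GE.
Qed.

Lemma computable_pair A B C (f : A -> B) (g : A -> C) :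
  computable f -> computable g -> computable (fun a => (f a, g a)).
Proof.
move=> [F recF FE] [G recG GE]; exists (fun x => code_pair (F x) (G x)).
  exact: recursive_app2 rec2_code_pair recF recG.
by move=> a; rewrite FE GE.
Qed.

Lemma computable_fst A B C (f : A -> B * C) :
  computable f -> computable (fun a => (f a).1).
Proof.
have [F recF FE] := rec1_code_fst.
by apply: computable_comp; exists F => // -[b c]; exact: FE.
Qed.

Lemma computable_snd A B C (f : A -> B * C) :
  computable f -> computable (fun a => (f a).2).
Proof.
have [F recF FE] := rec1_code_snd.
by apply: computable_comp; exists F => // -[b c]; exact: FE.
Qed.

Lemma computable_comp2 A B C T (h : B -> C -> T) (f : A -> B) (g : A -> C) :
  computable (fun p : B * C => h p.1 p.2) -> computable f -> computable g ->
  computable (fun a => h (f a) (g a)).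
Proof.
move=> comph compf compg.
exact: (computable_comp comph (computable_pair compf compg)).
Qed.

Lemma computable_iter A B (k : A -> nat) (f : A -> B -> B) (i : A -> B) :
  computable k -> computable (fun p : A * B => f p.1 p.2) -> computable i ->
  computable (fun a => iter (k a) (f a) (i a)).
Proof.
move=> [K recK KE] [F recF FE] [I recI IE].
exists (fun x => iteri (K x) (fun _ r => F (code_pair x r)) (I x)).
  apply: (rec1_iteri (G := fun _ r x => F (code_pair x r))) => //.
  by apply: recursive_app1 recF _; apply: (recursive_app2 rec2_code_pair); exact: rec_proj.
move=> a; rewrite KE IE [enc (k a)]/=.
by elim: (k a) => //= m ->; exact: FE (a, _).
Qed.

End ComputableBasics.

Ltac comp_proj :=
  solve [repeat first [exact: computable_id | exact: computable_const
    | apply: computable_fst | apply: computable_snd | apply: computable_pair]].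

Section ComputableSeq.
Implicit Types A B C T : codedType.

(** A nonempty sequence and the pair of its head and its tail have the same code,
    so that nothing has to be decoded. *)
Lemma computable_seq_case A B T (s : A -> seq T) (f : A -> B)
    (g : A -> T -> seq T -> B) :
  computable s -> computable f ->
  computable (fun p : A * (T * seq T) => g p.1 p.2.1 p.2.2) ->
  computable (fun a => if s a is x :: l then g a x l else f a).
Proof.
move=> [S recS SE] [F recF FE] [G recG GE].
exists (fun x => if S x == 0 then F x else G (code_pair x (S x))).
  apply: rec1_if0 => //; apply: (recursive_app1 recG).
  exact: recursive_app2 rec2_code_pair rec1_id recS.
move=> a; rewrite SE FE.
case: (s a) => [|x l] //.
rewrite -(GE (a, (x, l))).
case: eqP => //= eq0; have := code_pair_gt (enc l) (enc x).
by rewrite -[X in _ < X]/(enc (x :: l)) eq0.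
Qed.

Lemma computable_if A B (b : A -> bool) (f g : A -> B) :
  computable b -> computable f -> computable g ->
  computable (fun a => if b a then f a else g a).
Proof.
move=> [S recS SE] [F recF FE] [G recG GE].
exists (fun x => if S x == 0 then G x else F x); first exact: rec1_if0.
by move=> a; rewrite SE FE GE; case: (b a).
Qed.

Lemma computable_succ A (f : A -> nat) : computable f -> computable (fun a => (f a).+1).
Proof. by apply: computable_comp; exists S => //; exact: rec_succ. Qed.

Lemma computable_nat2 A op (f g : A -> nat) : rec2 op ->
  computable f -> computable g -> computable (fun a => op (f a) (g a)).
Proof.
move=> recop [F recF FE] [G recG GE]; exists (fun x => op (F x) (G x)).
  exact: recursive_app2 recop recF recG.
by move=> a; rewrite FE GE.
Qed.

Lemma computable_leq A (f g : A -> nat) :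
  computable f -> computable g -> computable (fun a => f a <= g a).
Proof.
move=> compf compg.
have comp0 : computable (fun x => x == 0).
  exists (fun x => 1 - x) => [|[|x]] //.
  exact: recursive_app2 rec2_subn (rec_const 1) rec1_id.
exact: computable_comp comp0 (computable_nat2 rec2_subn compf compg).
Qed.

Lemma computable_and A (f g : A -> bool) :
  computable f -> computable g -> computable (fun a => f a && g a).
Proof. by move=> compf compg; exact: computable_if (computable_const _ _). Qed.

Lemma computable_or A (f g : A -> bool) :
  computable f -> computable g -> computable (fun a => f a || g a).
Proof. by move=> compf compg; exact: computable_if (computable_const _ _) _. Qed.

Lemma computable_eq A B (f g : A -> B) :
  computable f -> computable g -> computable (fun a => f a == g a).
Proof.
move=> [F recF FE] [G recG GE].
have compF : computable (fun a => enc (f a)) by exists F.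
have compG : computable (fun a => enc (g a)) by exists G.
apply: computable_ext
  (computable_and (computable_leq compF compG) (computable_leq compG compF)).
by move=> a; rewrite -eqn_leq (inj_eq enc_inj).
Qed.

Lemma computable_enc A B (f : A -> B) : computable f -> computable (fun a => enc (f a)).
Proof. by move=> [F recF FE]; exists F. Qed.

Lemma computable_cons A T (x : A -> T) (s : A -> seq T) :
  computable x -> computable s -> computable (fun a => x a :: s a).
Proof.
move=> [X recX XE] [S recS SE]; exists (fun a => code_pair (X a) (S a)).
  exact: recursive_app2 rec2_code_pair recX recS.
by move=> a; rewrite XE SE.
Qed.

Lemma size_leq_enc T (s : seq T) : size s <= enc s.
Proof. by elim: s => //= x s /leq_ltn_trans; apply; exact: code_pair_gt. Qed.

Lemma computable_foldl A B T (f : A -> B -> T -> B) (i : A -> B) (s : A -> seq T) :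
  computable (fun p : A * (B * T) => f p.1 p.2.1 p.2.2) ->
  computable i -> computable s ->
  computable (fun a => foldl (f a) (i a) (s a)).
Proof.
move=> compf compi comps.
(* The state consists of the entries still to be read and the accumulator; the
   code of the sequence bounds the number of iterations. *)
pose step a (st : seq T * B) :=
  if st.1 is x :: l then (l, f a st.2 x) else st.
have stepE a k l b : size l <= k -> iter k (step a) (l, b) = ([::], foldl (f a) b l).
  elim: k l b => [|k IHk] [|x l] b // le_lk; rewrite iterSr.
    by rewrite /step /= IHk.
  by rewrite {2}/step /= IHk.
have comp_step : computable (fun p : A * (seq T * B) => step p.1 p.2).
  apply: (computable_seq_case (s := fun p : A * (seq T * B) => p.2.1)
           (f := fun p => p.2) (g := fun p x l => (l, f p.1 p.2.2 x))); try comp_proj.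
  apply: computable_pair; first by comp_proj.
  by apply: (computable_comp compf (f := fun p => (p.1.1, (p.1.2.2, p.2.1)))); comp_proj.
have comp_it := computable_iter (computable_enc comps) comp_step (computable_pair comps compi).
apply: computable_ext (computable_snd comp_it) => a /=.
by rewrite stepE // size_leq_enc.
Qed.


Lemma computable_foldr A B T (f : A -> T -> B -> B) (i : A -> B) (s : A -> seq T) :
  computable (fun p : A * (T * B) => f p.1 p.2.1 p.2.2) ->
  computable i -> computable s ->
  computable (fun a => foldr (f a) (i a) (s a)).
Proof.
move=> compf compi comps.
have comp_rev : computable (fun a => rev (s a)).
  have comp_catrev : computable (fun a => foldl (fun l x => x :: l) [::] (s a)).
    apply: computable_foldl comps; last exact: computable_const.
    by apply: computable_cons; comp_proj.
  apply: computable_ext comp_catrev => a.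
  by rewrite /rev; elim: (s a) [::] => //= x l IHl t.
pose g a b x := f a x b.
have compg : computable (fun p : A * (B * T) => g p.1 p.2.1 p.2.2).
  by apply: (computable_comp compf (f := fun p => (p.1, (p.2.2, p.2.1)))); comp_proj.
apply: computable_ext (computable_foldl compg compi comp_rev) => a.
by rewrite foldl_rev.
Qed.

Lemma computable_map A B T (f : A -> T -> B) (s : A -> seq T) :
  computable (fun p : A * T => f p.1 p.2) -> computable s ->
  computable (fun a => map (f a) (s a)).
Proof.
move=> compf comps.
apply: (computable_foldr (f := fun a x l => f a x :: l)) comps; last exact: computable_const.
apply: computable_cons; last by comp_proj.
by apply: (computable_comp compf (f := fun p => (p.1, p.2.1))); comp_proj.
Qed.

Lemma computable_cat A T (s t : A -> seq T) :
  computable s -> computable t -> computable (fun a => s a ++ t a).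
Proof.
move=> comps compt.
apply: (computable_ext (f := fun a => foldr cons (t a) (s a))).
  by move=> a; elim: (s a) => //= x l ->.
apply: (computable_foldr (f := fun _ x l => x :: l)) compt comps.
by apply: computable_cons; comp_proj.
Qed.

Lemma computable_flatten A T (s : A -> seq (seq T)) :
  computable s -> computable (fun a => flatten (s a)).
Proof.
move=> comps; rewrite /flatten.
apply: (computable_foldr (f := fun _ x l => x ++ l)) comps; last exact: computable_const.
by apply: computable_cat; comp_proj.
Qed.

Lemma computable_has A T (f : A -> T -> bool) (s : A -> seq T) :
  computable (fun p : A * T => f p.1 p.2) -> computable s ->
  computable (fun a => has (f a) (s a)).
Proof.
move=> compf comps.
apply: (computable_ext (f := fun a => foldr (fun x b => f a x || b) false (s a))).
  by move=> a; elim: (s a) => //= x l ->.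
apply: (computable_foldr (f := fun a x b => f a x || b)) comps; last exact: computable_const.
apply: computable_or; last by comp_proj.
by apply: (computable_comp compf (f := fun p => (p.1, p.2.1))); comp_proj.
Qed.

Lemma computable_mem A T (x : A -> T) (s : A -> seq T) :
  computable x -> computable s -> computable (fun a => x a \in s a).
Proof.
move=> compx comps.
apply: (computable_ext (f := fun a => has (fun y => y == x a) (s a))).
  by move=> a; rewrite has_pred1.
apply: computable_has comps; apply: computable_eq; first by comp_proj.
by apply: computable_comp compx _; comp_proj.
Qed.

Lemma computable_size A T (s : A -> seq T) :
  computable s -> computable (fun a => size (s a)).
Proof.
move=> comps.
apply: (computable_ext (f := fun a => foldr (fun _ k => k.+1) 0 (s a))).
  by move=> a; elim: (s a) => //= x l ->.
apply: computable_foldr comps; last exact: computable_const.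
by apply: computable_succ; comp_proj.
Qed.

(** A table of values, searched by comparing codes. *)
Lemma computable_fin T B (l : seq T) (f : T -> B) :
  (forall x, x \in l) -> computable f.
Proof.
move=> all_l.
suff [F recF FE] : exists2 F, rec1 F & {in l, forall x, F (enc x) = enc (f x)}.
  by exists F => // x; exact: FE.
elim: l {all_l} => [|x l [F recF FE]]; first by exists id => //; exact: rec1_id.
have [E recE EE] : computable (fun c => c == enc x).
  by apply: computable_eq; [exact: computable_id | exact: computable_const].
exists (fun c => if E c == 0 then F c else enc (f x)).
  by apply: rec1_if0 => //; exact: rec_const.
move=> y; rewrite inE -[E _]/(E (enc (enc y))) EE (inj_eq enc_inj).
by case: eqP => [-> | _] // /FE.
Qed.

(** Here [l] is not an input, so that [I] does not have to be coded. *)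
Lemma computable_has_const A (I : Type) (l : seq I) (p : I -> A -> bool) :
  (forall i, computable (p i)) -> computable (fun a => has (p^~ a) l).
Proof.
move=> compp; elim: l => [|i l IHl]; first exact: computable_const.
exact: computable_or.
Qed.

Definition seqs_upto T (l : seq T) N : seq (seq T) :=
  iter N (fun L => [::] :: flatten [seq [seq x :: s | s <- L] | x <- l]) [:: [::]].

Lemma mem_seqs_upto T (l : seq T) N s :
  all [in l] s -> size s <= N -> s \in seqs_upto l N.
Proof.
elim: N s => [|N IHN] [|x s] //=; rewrite inE //= ltnS => /andP[lx ls] le_sN.
apply/flattenP; exists [seq x :: s | s <- seqs_upto l N]; first exact: map_f.
by apply: map_f; exact: IHN.
Qed.

Lemma computable_seqs_upto A T (l : seq T) (N : A -> nat) :
  computable N -> computable (fun a => seqs_upto l (N a)).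
Proof.
move=> compN.
apply: (computable_iter (f := fun _ L => _)) => //; last exact: computable_const.
apply: computable_cons; first exact: computable_const.
apply: computable_flatten.
apply: (computable_map (f := fun p x => [seq x :: s | s <- p.2])); last exact: computable_const.
apply: (computable_map (f := fun p s => p.2 :: s)); last by comp_proj.
by apply: computable_cons; comp_proj.
Qed.

End ComputableSeq.

(** * The positive braid monoid *)

Definition far (i j : nat) := (i.+1 < j) || (j.+1 < i).
Definition adj (i j : nat) := (j == i.+1) || (i == j.+1).

Lemma far_sym i j : far i j = far j i. Proof. exact: orbC. Qed.
Lemma adj_sym i j : adj i j = adj j i. Proof. exact: orbC. Qed.

(** One application of a braid relation to a positive word.  The generators are
    all natural numbers: a bound on them is preserved by moves and is imposed only
    where it matters. *)
Inductive braid_move : seq nat -> seq nat -> Prop :=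
| move_far i j s : far i j -> braid_move [:: i, j & s] [:: j, i & s]
| move_adj i j s : adj i j -> braid_move [:: i, j, i & s] [:: j, i, j & s]
| move_cons i s t : braid_move s t -> braid_move (i :: s) (i :: t).

(** Chains of moves, in the form needed to cut a chain after its first move. *)
Inductive peq : seq nat -> seq nat -> Prop :=
| peq_refl s : peq s s
| peq_move s t u : braid_move s t -> peq t u -> peq s u.

Notation "s =+ t" := (peq s t) (at level 70).

#[local] Hint Resolve peq_refl : core.

Lemma move_sym s t : braid_move s t -> braid_move t s.
Proof.
elim=> [i j u far_ij|i j u adj_ij|i u v _ IHm].
- by apply: move_far; rewrite far_sym.
- by apply: move_adj; rewrite adj_sym.
- exact: move_cons.
Qed.

Lemma move_peq s t : braid_move s t -> s =+ t.
Proof. by move=> st; apply: peq_move st (peq_refl t). Qed.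

Lemma peq_trans s t u : s =+ t -> t =+ u -> s =+ u.
Proof. by elim=> // v w x vw _ IH /IH; exact: peq_move. Qed.

Lemma peq_sym s t : s =+ t -> t =+ s.
Proof.
elim=> [u|u v w uv _ wv]; first exact: peq_refl.
by apply: peq_trans wv (move_peq (move_sym uv)).
Qed.

#[local] Instance peq_equiv : Equivalence peq.
Proof. by split; [exact: peq_refl | exact: peq_sym | exact: peq_trans]. Qed.

#[local] Instance peq_cons : Proper (eq ==> peq ==> peq) cons.
Proof.
move=> i _ <- s t; elim=> [u|u v w uv _ IH]; first exact: peq_refl.
exact: peq_move (move_cons i uv) IH.
Qed.

#[local] Instance peq_cat : Proper (peq ==> peq ==> peq) cat.
Proof.
move=> s t st u v uv; apply: (peq_trans (t := t ++ u)).
  elim: st => [w|w x y wx _]; first exact: peq_refl.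
  apply: peq_trans; apply: move_peq.
  elim: wx => [i j z|i j z|i z z' _]; [exact: move_far | exact: move_adj | exact: move_cons].
by elim: t {st} => //= i t IHt; rewrite IHt.
Qed.

Lemma peq_far i j s : far i j -> [:: i, j & s] =+ [:: j, i & s].
Proof. by move=> far_ij; exact/move_peq/move_far. Qed.

Lemma peq_adj i j s : adj i j -> [:: i, j, i & s] =+ [:: j, i, j & s].
Proof. by move=> adj_ij; exact/move_peq/move_adj. Qed.

Lemma size_move s t : braid_move s t -> size s = size t.
Proof. by elim=> //= i u v _ ->. Qed.

Lemma size_peq s t : s =+ t -> size s = size t.
Proof. by elim=> // u v w uv _ <-; exact: size_move. Qed.

(** [i :: residue i j] and [j :: residue j i] are the two standard words for the
    least common multiple of the generators [i] and [j]. *)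
Definition residue (i j : nat) : seq nat :=
  if i == j then [::] else if far i j then [:: j] else [:: j; i].

(** If [i :: x] and [j :: y] are equivalent, then this says that the least common
    multiple of [i] and [j] divides their class. *)
Definition factors i j x y :=
  exists z, x =+ residue i j ++ z /\ y =+ residue j i ++ z.

Lemma factors_sym i j x y : factors i j x y -> factors j i y x.
Proof. by case=> z [xz yz]; exists z. Qed.

Lemma residue_refl i : residue i i = [::]. Proof. by rewrite /residue eqxx. Qed.

Lemma residue_far i j : far i j -> residue i j = [:: j].
Proof. by rewrite /residue /far; case: eqP => [->|_ -> //]; lia. Qed.

Lemma residue_adj i j : adj i j -> residue i j = [:: j; i].
Proof.
rewrite /residue => adj_ij; rewrite ifF ?ifF //; apply/negbTE/negP;
  by move: adj_ij; rewrite /adj /far; lia.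
Qed.

Lemma generatorsP i j : [\/ i = j, far i j | adj i j].
Proof.
have: [|| i == j, far i j | adj i j] by rewrite /far /adj; lia.
by case/or3P => [/eqP||]; [constructor 1 | constructor 2 | constructor 3].
Qed.

Lemma factors_eq i x y : x =+ y -> factors i i x y.
Proof. by move=> xy; exists y; rewrite residue_refl. Qed.

Lemma factors_farP i j x y : far i j ->
  factors i j x y <-> exists2 z, x =+ j :: z & y =+ i :: z.
Proof.
move=> far_ij; rewrite /factors !residue_far // 1?far_sym //.
by split=> -[z]; [case=> xz yz | move=> xz yz]; exists z.
Qed.

Lemma factors_adjP i j x y : adj i j ->
  factors i j x y <-> exists2 z, x =+ [:: j, i & z] & y =+ [:: i, j & z].
Proof.
move=> adj_ij; rewrite /factors !residue_adj // 1?adj_sym //.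
by split=> -[z]; [case=> xz yz | move=> xz yz]; exists z.
Qed.

Section Cube.

(** Garside's induction: the factorization property is assumed for words of
    length less than [L]. *)
Variable L : nat.
Hypothesis IH : forall i j x y,
  size x < L -> i :: x =+ j :: y -> factors i j x y.

Lemma cancel_below i x y : size x < L -> i :: x =+ i :: y -> x =+ y.
Proof. by move=> lt_xL /(IH lt_xL)[z []]; rewrite residue_refl /= => xz yz; rewrite xz yz. Qed.

Lemma factors_far i j x y : far i j -> size x < L -> i :: x =+ j :: y ->
  exists2 z, x =+ j :: z & y =+ i :: z.
Proof. by move=> far_ij lt_xL /(IH lt_xL)/(factors_farP _ _ far_ij). Qed.

Lemma factors_adj i j x y : adj i j -> size x < L -> i :: x =+ j :: y ->
  exists2 z, x =+ [:: j, i & z] & y =+ [:: i, j & z].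
Proof. by move=> adj_ij lt_xL /(IH lt_xL)/(factors_adjP _ _ adj_ij). Qed.

(** Two factorizations sharing a middle term [k :: w] are merged.  The induction
    hypothesis, applied to the two expressions for [w], yields a common multiple
    which is then rewritten by braid relations.  Up to exchanging [i] and [j],
    three positions of [k] with respect to [i] and [j] have to be considered. *)
Lemma cube_far_far i k j x w y : far i k -> far k j ->
  size w = L -> factors i k x w -> factors k j w y -> factors i j x y.
Proof.
move=> far_ik far_kj size_w.
move=> /(factors_farP _ _ far_ik)[z xz wz] /(factors_farP _ _ far_kj)[z' wz' yz'].
have size_z: size z < L by rewrite -size_w (size_peq wz).
have zz': i :: z =+ j :: z' by rewrite -wz wz'.
have [eq_ij|far_ij|adj_ij] := generatorsP i j.
- subst j; apply: factors_eq.
  by rewrite xz yz' (cancel_below size_z zz').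
- have [t zt zt'] := factors_far far_ij size_z zz'.
  apply/factors_farP => //; exists (k :: t).
    by rewrite xz zt peq_far.
  by rewrite yz' zt' peq_far 1?far_sym.
have [t zt zt'] := factors_adj adj_ij size_z zz'.
apply/factors_adjP => //; exists (k :: t).
  by rewrite xz zt (peq_far _ far_kj) (peq_far (i := k)) 1?far_sym.
by rewrite yz' zt' (peq_far (i := k)) 1?far_sym // (peq_far _ far_kj).
Qed.

Lemma cube_far_adj i k j x w y : far i k -> adj k j ->
  size w = L -> factors i k x w -> factors k j w y -> factors i j x y.
Proof.
move=> far_ik adj_kj size_w.
move=> /(factors_farP _ _ far_ik)[z xz wz] /(factors_adjP _ _ adj_kj)[z' wz' yz'].
have size_z: size z < L by rewrite -size_w (size_peq wz).
have size_z': size (k :: z') < L by rewrite -size_w (size_peq wz').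
have zz': i :: z =+ [:: j, k & z'] by rewrite -wz wz'.
have [eq_ij|far_ij|adj_ij] := generatorsP i j.
- by move: far_ik adj_kj; rewrite eq_ij /far /adj; lia.
- have [p zp kz'] := factors_far far_ij size_z zz'.
  have far_ki : far k i by rewrite far_sym.
  have [q z'q pq] := factors_far far_ki (ltnW size_z') kz'.
  apply/factors_farP => //; exists [:: k, j & q].
    by rewrite xz zp pq (peq_adj _ adj_kj).
  by rewrite yz' z'q (peq_far (i := j)) 1?far_sym // (peq_far _ far_ki).
have [p zp kz'] := factors_adj adj_ij size_z zz'.
have far_ki : far k i by rewrite far_sym.
have [q z'q pq] := factors_far far_ki (ltnW size_z') kz'.
have size_p : size p < L.
  by rewrite -ltnS; apply: ltn_trans size_z; rewrite (size_peq zp).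
have adj_jk : adj j k by rewrite adj_sym.
have [r pr qr] := factors_adj adj_jk size_p pq.
have adj_ji : adj j i by rewrite adj_sym.
apply/factors_adjP => //; exists [:: k, j, i & r].
  rewrite xz zp pr (peq_far _ far_ik) (peq_adj _ adj_kj).
  by rewrite (peq_adj _ adj_ji) (peq_far _ far_ki).
rewrite yz' z'q qr (peq_adj _ adj_ji) (peq_far [:: j, i, k & r] far_ki).
by rewrite (peq_far r far_ik) (peq_adj _ adj_kj).
Qed.

Lemma cube_adj_adj i k j x w y : adj i k -> adj k j ->
  size w = L -> factors i k x w -> factors k j w y -> factors i j x y.
Proof.
move=> adj_ik adj_kj.
have adj_ki : adj k i by rewrite adj_sym.
have adj_jk : adj j k by rewrite adj_sym.
move=> size_w.
move=> /(factors_adjP _ _ adj_ik)[z xz wz] /(factors_adjP _ _ adj_kj)[z' wz' yz'].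
have size_z: size (k :: z) < L by rewrite -size_w (size_peq wz).
have size_z': size (k :: z') < L by rewrite -size_w (size_peq wz').
have zz': [:: i, k & z] =+ [:: j, k & z'] by rewrite -wz wz'.
have [eq_ij|far_ij|adj_ij] := generatorsP i j.
- subst j; apply: factors_eq.
  have := cancel_below (ltnW size_z) (cancel_below size_z zz').
  by move=> zz; rewrite xz yz' zz.
- have [p kz kz'] := factors_far far_ij size_z zz'.
  have [q zq pq] := factors_adj adj_kj (ltnW size_z) kz.
  have [q' zq' pq'] := factors_adj adj_ki (ltnW size_z') kz'.
  have size_q : size q < L by move: size_z; rewrite /= (size_peq zq) /=; lia.
  have qq' : j :: q =+ i :: q'.
    apply: (cancel_below (i := k)); last by rewrite -pq.
    by move: size_z; rewrite /= (size_peq zq) /=; lia.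
  have far_ji : far j i by rewrite far_sym.
  have [r qr q'r] := factors_far far_ji size_q qq'.
  apply/factors_farP => //; exists [:: k, j, i, k & r].
    rewrite xz zq qr (peq_far _ far_ij) (peq_adj r adj_ik).
    by rewrite (peq_adj _ adj_kj).
  rewrite yz' zq' q'r (peq_far _ far_ji) (peq_adj r adj_jk).
  by rewrite (peq_adj _ adj_ki) (peq_far _ far_ij).
by move: adj_ik adj_kj adj_ij; rewrite /adj; lia.
Qed.

Lemma cube i k j x w y :
  size w = L -> factors i k x w -> factors k j w y -> factors i j x y.
Proof.
move=> size_w ik kj.
have [eq_ik|far_ik|adj_ik] := generatorsP i k.
- subst k; case: ik kj => u; rewrite residue_refl => -[xu wu] [z [wz yz]].
  by exists z; rewrite xu -wu.
- have [eq_kj|far_kj|adj_kj] := generatorsP k j.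
  + subst k; case: kj ik => u; rewrite residue_refl => -[wu yu] [z [xz wz]].
    by exists z; rewrite yu -wu.
  + exact: cube_far_far ik kj.
  + exact: cube_far_adj ik kj.
have [eq_kj|far_kj|adj_kj] := generatorsP k j.
- subst k; case: kj ik => u; rewrite residue_refl => -[wu yu] [z [xz wz]].
  by exists z; rewrite yu -wu.
- have far_jk : far j k by rewrite far_sym.
  have adj_ki : adj k i by rewrite adj_sym.
  by apply: factors_sym; exact: cube_far_adj size_w (factors_sym kj) (factors_sym ik).
- exact: cube_adj_adj ik kj.
Qed.

End Cube.

Lemma move_factors i x u : braid_move (i :: x) u ->
  exists k w, u = k :: w /\ factors i k x w.
Proof.
move eq_s: (i :: x) => s su.
case: su eq_s => [j k z far_jk|j k z adj_jk|j z z' zz'] [-> ->].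
- exists k, (j :: z); split=> //; apply/factors_farP => //; by exists z.
- exists k, [:: j, k & z]; split=> //; apply/factors_adjP => //; by exists z.
- exists j, z'; split=> //; apply: factors_eq; exact: move_peq.
Qed.

(** Garside's lemma.  A chain of moves from [i :: x] to [j :: y] is cut after its
    first step; the two parts are merged by the cube property, which calls upon
    the lemma for shorter words only. *)
Lemma garside i j x y : i :: x =+ j :: y -> factors i j x y.
Proof.
have [L] := ubnP (size x); elim: L => // L IHL in i j x y *.
rewrite ltnS leq_eqVlt => /orP[/eqP size_x|]; last exact: IHL.
move eq_s: (i :: x) => s; move eq_t: (j :: y) => t st.
elim: st i x size_x eq_s eq_t => [u|u v w uv vw IHc] i x size_x eq_s eq_t.
  by move: eq_t; rewrite -eq_s => -[-> ->]; exact: factors_eq.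
rewrite -eq_s in uv; have [k [z [eq_v ik]]] := move_factors uv.
have size_z : size z = L.
  by have := size_move uv; rewrite eq_v /= size_x => -[].
by apply: (cube (L := L) _ size_z ik); [move=> *; exact: IHL | exact: IHc].
Qed.

Lemma peq_cancel_cons i x y : i :: x =+ i :: y -> x =+ y.
Proof. by move=> /garside[z []]; rewrite residue_refl => xz yz; rewrite xz yz. Qed.

Lemma peq_cancel u x y : u ++ x =+ u ++ y -> x =+ y.
Proof. by elim: u => //= i u IHu /peq_cancel_cons. Qed.

Lemma move_all m s t : braid_move s t -> all (gtn m) s -> all (gtn m) t.
Proof.
elim=> [i j u _|i j u _|i u v _ IH] /=; [| |by case/andP=> -> /IH].
  by case/and3P=> -> -> ->.
by case/and4P=> lt_i lt_j _ u_lt; rewrite lt_i lt_j u_lt.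
Qed.

(** * A central element *)

Section Center.

Variable m : nat.

Definition delta : seq nat := iota 0 m.

Definition dpow k : seq nat := flatten (nseq k delta).

(** The full twist, usually written as the square of the half twist; powers of
    [delta] are easier to commute with generators. *)
Definition twist : seq nat := dpow m.+1.

Lemma dpowD k l : dpow (k + l) = dpow k ++ dpow l.
Proof. by rewrite /dpow nseqD flatten_cat. Qed.

Lemma dpow1 : dpow 1 = delta. Proof. exact: cats0. Qed.

Lemma iota_far i l k : i.+1 < k -> iota k l ++ [:: i] =+ i :: iota k l.
Proof.
elim: l k => //= l IHl k lt_ik.
by rewrite IHl 1?peq_far ?/far ?lt_ik ?orbT //; lia.
Qed.

Lemma iota_far_r i l k : k + l < i -> iota k l ++ [:: i] =+ i :: iota k l.
Proof.
elim: l k => //= l IHl k lt_ki.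
by rewrite IHl 1?peq_far ?/far //; lia.
Qed.

(** In [delta ++ [:: i]] the letter [i] moves to the left up to the factor
    [i, i.+1], where a braid relation replaces it by [i.+1]. *)
Lemma delta_shift i : i.+1 < m -> delta ++ [:: i] =+ i.+1 :: delta.
Proof.
move=> lt_im; rewrite /delta.
have -> : m = i + (2 + (m - i.+2)) by lia.
rewrite !iotaD add0n addn2 /=; set r := iota _ _.
rewrite -catA /= iota_far // (peq_adj _ (_ : adj i i.+1)); last by rewrite /adj eqxx.
have := @iota_far_r i.+1 i 0 (ltnSn i).
by move=> A_i; rewrite -cat_cons -A_i -catA.
Qed.

Lemma dpow_shift k i : k + i < m -> dpow k ++ [:: i] =+ (k + i) :: dpow k.
Proof.
elim: k => [|k IHk] //= lt_kim.
rewrite -catA IHk; last by lia.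
by rewrite -cat1s catA delta_shift // addSn -cat1s.
Qed.

Lemma delta_cons : 0 < m -> delta = 0 :: iota 1 m.-1.
Proof. by rewrite /delta; case: m. Qed.

Lemma delta_rcons : 0 < m -> delta = iota 0 m.-1 ++ [:: m.-1].
Proof. by rewrite /delta; case: m => // p _; rewrite -{1}[p.+1]addn1 iotaD. Qed.

Lemma delta_shift_iota k l : k + l < m -> delta ++ iota k l =+ iota k.+1 l ++ delta.
Proof.
elim: l k => [|l IHl] k lt_klm; first by rewrite cats0.
rewrite /= -cat1s catA delta_shift; last by lia.
by rewrite /= IHl; last by lia.
Qed.

(** Conjugation by [delta] sends each generator to the next one.  From the last
    generator it takes two steps to come back to the first one, as if there were
    one more generator in between; hence [m.+1] steps make a full turn. *)
Lemma delta2_last : 0 < m -> dpow 2 ++ [:: m.-1] =+ 0 :: dpow 2.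
Proof.
move=> m_gt0; rewrite /dpow /= cats0.
have dd : delta ++ delta =+ iota 1 m.-1 ++ delta ++ [:: m.-1].
  rewrite {2}(delta_rcons m_gt0) catA delta_shift_iota; last by lia.
  by rewrite -catA.
have -> : (delta ++ delta) ++ [:: m.-1] = 0 :: iota 1 m.-1 ++ delta ++ [:: m.-1].
  by rewrite -cat_cons -(delta_cons m_gt0) -catA.
by rewrite -dd.
Qed.

(** The [m.+1] factors [delta] are split according to the path of [i]: up to the
    last generator, from there to the first one, and back to [i]. *)
Lemma twist_central_gen i : i < m -> twist ++ [:: i] =+ i :: twist.
Proof.
move=> lt_im; rewrite /twist.
have -> : m.+1 = i + (2 + (m.-1 - i)) by lia.
set r := m.-1 - i; have r_i : r + i = m.-1 by rewrite /r; lia.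
rewrite !dpowD -(catA (dpow i)) -(catA (dpow 2)) dpow_shift r_i; last by lia.
rewrite -(cat1s m.-1) (catA (dpow 2)) delta2_last; last by lia.
rewrite cat_cons -(cat1s 0) (catA (dpow i)) dpow_shift addn0 //.
Qed.

Lemma twist_central s : all (gtn m) s -> twist ++ s =+ s ++ twist.
Proof.
elim: s => [|i s IHs] /=; first by rewrite cats0.
by case/andP=> lt_im /IHs tw_s; rewrite -cat1s catA twist_central_gen //= tw_s.
Qed.

Definition cofactor i := dpow i ++ iota 1 m.-1 ++ dpow (m - i).

Lemma cofactorl i : i < m -> i :: cofactor i =+ twist.
Proof.
move=> lt_im; rewrite /twist.
have -> : m.+1 = i + (1 + (m - i)) by lia.
rewrite !dpowD dpow1 delta_cons; last by lia.
by rewrite cat_cons -(cat1s 0) (catA (dpow i)) dpow_shift addn0.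
Qed.

(** Centrality turns the left complement into a right one after multiplication by
    [i] on the left. *)
Lemma cofactorr i : i < m -> cofactor i ++ [:: i] =+ twist.
Proof.
move=> lt_im; apply: (@peq_cancel_cons i).
by rewrite -cat_cons cofactorl // twist_central_gen.
Qed.

Lemma dpow_all k : all (gtn m) (dpow k).
Proof.
rewrite /dpow; elim: k => //= k IHk; rewrite all_cat IHk andbT.
by apply/allP => i; rewrite mem_iota.
Qed.

Lemma twist_all : all (gtn m) twist. Proof. exact: (dpow_all m.+1). Qed.

Lemma cofactor_all i : i < m -> all (gtn m) (cofactor i).
Proof.
move=> lt_im; rewrite /cofactor !all_cat !dpow_all /= andbT.
by apply/allP => j; rewrite mem_iota /=; lia.
Qed.

Lemma twist_pow_central k s : all (gtn m) s ->
  flatten (nseq k twist) ++ s =+ s ++ flatten (nseq k twist).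
Proof.
move=> s_lt; elim: k => [|k IHk] /=; first by rewrite cats0.
by rewrite -catA IHk catA twist_central // catA.
Qed.

End Center.

(** * Reduction of the word problem to positive words *)

Section WordProblem.

Variable n : nat.
Implicit Types (u v w : word n) (x : letter n).

Local Notation m := n.-1.

(** Inverse letters are multiplied by the full twist to become positive; [neg]
    counts the factors introduced in this way. *)
Definition pos_letter x : seq nat := if x.2 then cofactor m x.1 else [:: val x.1].
Definition pos w : seq nat := flatten (map pos_letter w).
Definition neg w : nat := count snd w.
Definition tw k : seq nat := flatten (nseq k (twist m)).

Lemma pos_cat u v : pos (u ++ v) = pos u ++ pos v.
Proof. by rewrite /pos map_cat flatten_cat. Qed.

Lemma neg_cat u v : neg (u ++ v) = neg u + neg v.
Proof. exact: count_cat. Qed.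

Lemma twD k l : tw (k + l) = tw k ++ tw l.
Proof. by rewrite /tw nseqD flatten_cat. Qed.

Lemma tw_all k : all (gtn m) (tw k).
Proof. by elim: k => //= k IHk; rewrite -[tw k.+1]/(twist m ++ tw k) all_cat twist_all. Qed.

Lemma pos_all w : all (gtn m) (pos w).
Proof.
elim: w => //= -[i b] w IHw; rewrite all_cat IHw andbT /pos_letter /=.
by case: b => /=; [exact: cofactor_all | rewrite ltn_ord].
Qed.

Lemma tw_central k s : all (gtn m) s -> tw k ++ s =+ s ++ tw k.
Proof. exact: twist_pow_central. Qed.

(** Equality of [u] and [v] in the group of fractions of the positive monoid,
    with powers of the full twist as the only denominators. *)
Definition balanced u v := pos u ++ tw (neg v) =+ pos v ++ tw (neg u).

(** Left cancellation enters through the power of the full twist that clears the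
    denominator of [v]. *)
Lemma balanced_trans u v w : balanced u v -> balanced v w -> balanced u w.
Proof.
rewrite /balanced => uv vw; apply: (@peq_cancel (tw (neg v))).
rewrite catA (tw_central _ (pos_all u)) uv -catA -twD addnC twD catA vw.
by rewrite -(tw_central _ (pos_all w)) catA.
Qed.

Lemma balanced_relation u v : braid_relation u v -> balanced u v.
Proof.
rewrite /balanced; case=> [i|i|i j far_ij|i j adj_ij] /=.
- by rewrite /pos /= /pos_letter /= !cats0 (cofactorl (ltn_ord i)) /tw /= cats0.
- by rewrite /pos /= /pos_letter /= !cats0 (cofactorr (ltn_ord i)) /tw /= cats0.
- exact: peq_far.
- by apply: peq_adj; rewrite /adj adj_ij eqxx.
Qed.

Lemma balanced_context a b u v :
  balanced u v -> balanced (a ++ u ++ b) (a ++ v ++ b).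
Proof.
have move_tw (s t : word n) : pos (a ++ s ++ b) ++ tw (neg (a ++ t ++ b)) =+
    pos a ++ (pos s ++ tw (neg t)) ++ pos b ++ tw (neg a + neg b).
  rewrite !pos_cat !neg_cat addnCA twD -!catA.
  by rewrite (catA (pos b)) -(tw_central _ (pos_all b)) -!catA.
by rewrite /balanced !move_tw => ->.
Qed.

Lemma braid_eq_balanced u v : braid_eq u v -> balanced u v.
Proof.
elim=> [a b s t st|s|s t _|s t w _ st _ tw].
- exact/balanced_context/balanced_relation.
- by rewrite /balanced.
- exact: peq_sym.
- exact: balanced_trans tw.
Qed.

(** ** Positive words as braid words *)

#[local] Hint Resolve braid_eq_refl : core.

#[local] Instance braid_eq_equiv : Equivalence (@braid_eq n).
Proof.
by split; [exact: braid_eq_refl | exact: braid_eq_sym | exact: braid_eq_trans].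
Qed.

Lemma braid_eq_context a b u v : braid_eq u v -> braid_eq (a ++ u ++ b) (a ++ v ++ b).
Proof.
elim=> [c d s t st|s|s t _|s t w _ st _ tw].
- have := braid_eq_rel (a ++ c) (d ++ b) st.
  by rewrite -!catA.
- exact: braid_eq_refl.
- exact: braid_eq_sym.
- exact: braid_eq_trans tw.
Qed.

#[local] Instance braid_eq_cat : Proper (@braid_eq n ==> @braid_eq n ==> @braid_eq n) cat.
Proof.
move=> u v uv s t st; apply: (braid_eq_trans (v := v ++ s)).
  exact: (braid_eq_context [::] s uv).
by have := braid_eq_context v [::] st; rewrite !cats0.
Qed.

#[local] Instance braid_eq_cons : Proper (eq ==> @braid_eq n ==> @braid_eq n) cons.
Proof. by move=> x _ <- u v uv; rewrite -cat1s uv. Qed.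

Definition word_inv w : word n := rev (map (fun x => (x.1, ~~ x.2)) w).

Lemma cat_word_inv w : braid_eq (w ++ word_inv w) [::].
Proof.
elim: w => [|[i b] w IHw] /=; first by [].
rewrite /word_inv /= rev_cons -cats1 catA IHw /=.
by case: b; [exact: (braid_eq_rel [::] [::] (braid_invl i))
            | exact: (braid_eq_rel [::] [::] (braid_invr i))].
Qed.

Lemma braid_eq_cancel u v w : braid_eq (u ++ w) (v ++ w) -> braid_eq u v.
Proof.
have catK s : braid_eq ((s ++ w) ++ word_inv w) s.
  by rewrite -catA cat_word_inv cats0.
by move=> uv; rewrite -(catK u) uv catK.
Qed.

Definition braid_of (s : seq nat) : word n := [seq sigma i | i <- pmap insub s].

Lemma braid_of_cat s t : braid_of (s ++ t) = braid_of s ++ braid_of t.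
Proof. by rewrite /braid_of pmap_cat map_cat. Qed.

Lemma braid_of_cons i s (lt_im : i < m) :
  braid_of (i :: s) = sigma (Ordinal lt_im) :: braid_of s.
Proof. by rewrite /braid_of /= insubT. Qed.

Lemma move_braid s t : braid_move s t -> all (gtn m) s -> braid_eq (braid_of s) (braid_of t).
Proof.
elim=> [i j u far_ij|i j u adj_ij|i u v _ IH] /=.
- case/and3P=> lt_i lt_j _; rewrite !braid_of_cons.
  exact: (braid_eq_rel [::] _ (braid_far (i := Ordinal lt_i) (j := Ordinal lt_j) far_ij)).
- case/and4P=> lt_i lt_j _ _; rewrite !braid_of_cons.
  case/orP: adj_ij => /eqP adj_ij.
    exact: (braid_eq_rel [::] _ (braid_adj (i := Ordinal lt_i) (j := Ordinal lt_j) adj_ij)).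
  apply: braid_eq_sym.
  exact: (braid_eq_rel [::] _ (braid_adj (i := Ordinal lt_j) (j := Ordinal lt_i) adj_ij)).
- by case/andP=> lt_i /IH uv; rewrite !braid_of_cons uv.
Qed.

Lemma peq_braid s t : s =+ t -> all (gtn m) s -> braid_eq (braid_of s) (braid_of t).
Proof.
elim=> [u _|u v w uv _ IH u_lt]; first by [].
exact: braid_eq_trans (move_braid uv u_lt) (IH (move_all uv u_lt)).
Qed.

(** For inverse letters, centrality of the full twist is a consequence of the case
    of generators in the group. *)
Lemma braid_tw_central k w : braid_eq (braid_of (tw k) ++ w) (w ++ braid_of (tw k)).
Proof.
elim: w => [|[i b] w IHw]; first by rewrite cats0.
have tw_i : braid_eq (braid_of (tw k) ++ [:: sigma i]) (sigma i :: braid_of (tw k)).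
  have i_lt : all (gtn m) [:: val i] by rewrite /= ltn_ord.
  have := peq_braid (tw_central k i_lt).
  rewrite all_cat tw_all i_lt !braid_of_cat (braid_of_cons _ (ltn_ord i)).
  by rewrite (_ : Ordinal _ = i) ?cat1s; [exact | exact: val_inj].
rewrite -cat1s catA; apply: (braid_eq_trans (v := ((i, b) :: braid_of (tw k)) ++ w)); last first.
  by rewrite /= IHw.
apply: (braid_eq_cat _ (braid_eq_refl w)).
case: b => //; apply: (@braid_eq_cancel _ _ [:: sigma i]).
rewrite -catA /= tw_i.
rewrite (braid_eq_rel (braid_of (tw k)) [::] (braid_invl i)) !cats0.
by symmetry; exact: (braid_eq_rel [::] (braid_of (tw k)) (braid_invl i)).
Qed.

Lemma braid_pos_letter x : braid_eq (braid_of (pos_letter x)) (x :: braid_of (tw x.2)).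
Proof.
case: x => i [] /=; rewrite /pos_letter /=; last first.
  by rewrite (braid_of_cons _ (ltn_ord i)) (_ : Ordinal _ = i); [exact: braid_eq_refl | exact: val_inj].
have := peq_braid (cofactorl (ltn_ord i)).
rewrite /= ltn_ord (cofactor_all (ltn_ord i)) (braid_of_cons _ (ltn_ord i)).
rewrite (_ : Ordinal _ = i); last exact: val_inj.
rewrite (_ : tw true = twist m); last by rewrite /tw /= cats0.
move=> /(_ isT) i_cof; rewrite -i_cof.
by symmetry; exact: (braid_eq_rel [::] _ (braid_invl i)).
Qed.

Lemma braid_pos w : braid_eq (braid_of (pos w)) (w ++ braid_of (tw (neg w))).
Proof.
elim: w => [|x w IHw] //.
rewrite -[pos _]/(pos_letter x ++ pos w) -[neg _]/(x.2 + neg w) twD !braid_of_cat.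
rewrite braid_pos_letter IHw cat_cons catA braid_tw_central.
by rewrite cat_cons -catA.
Qed.

Lemma balanced_braid_eq u v : balanced u v -> braid_eq u v.
Proof.
move=> uv; have := peq_braid uv.
rewrite all_cat pos_all tw_all !braid_of_cat => /(_ isT) uv'.
apply: (@braid_eq_cancel _ _ (braid_of (tw (neg u + neg v)))).
rewrite {1}twD addnC twD !braid_of_cat !catA.
by rewrite -!braid_pos.
Qed.

Lemma braid_eqP u v : braid_eq u v <-> balanced u v.
Proof. by split; [exact: braid_eq_balanced | exact: balanced_braid_eq]. Qed.

End WordProblem.

(** * Deciding the word problem *)

Definition root_moves (s : seq nat) : seq (seq nat) :=
  if s is i :: s1 then
    if s1 is j :: s2 then
      (if far i j then [:: [:: j, i & s2]] else [::]) ++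
      (if s2 is k :: s3 then
         if adj i j && (k == i) then [:: [:: j, i, j & s3]] else [::]
       else [::])
    else [::]
  else [::].

Fixpoint moves (s : seq nat) : seq (seq nat) :=
  if s is i :: s1 then root_moves s ++ map (cons i) (moves s1) else [::].

Lemma movesP s t : reflect (braid_move s t) (t \in moves s).
Proof.
apply: (iffP idP).
  elim: s t => //= i s IHs t; rewrite mem_cat => /orP[|/mapP[u /IHs su ->]].
    case: s {IHs} => //= j s; rewrite mem_cat => /orP[].
      by case: ifP => // far_ij; rewrite inE => /eqP->; exact: move_far.
    case: s => // k s; case: ifP => // /andP[adj_ij /eqP->].
    by rewrite inE => /eqP->; exact: move_adj.
  exact: move_cons.
elim=> [i j u far_ij|i j u adj_ij|i u v _ IH] /=; rewrite !mem_cat.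
- by rewrite far_ij inE eqxx.
- by rewrite adj_ij eqxx inE eqxx orbT.
- by rewrite map_f ?orbT.
Qed.

Definition expand (L : seq (seq nat)) := flatten [seq s :: moves s | s <- L].

Definition reach N s := iter N expand [:: s].

Lemma sub_expand L s : s \in L -> s \in expand L.
Proof. by move=> Ls; apply/flatten_mapP; exists s => //; rewrite inE eqxx. Qed.

Lemma reach_sound N s t : t \in reach N s -> peq s t.
Proof.
elim: N t => [|N IHN] t; first by rewrite inE => /eqP->.
case/flatten_mapP=> u /IHN su; rewrite inE => /predU1P[-> //|/movesP ut].
exact: peq_trans su (move_peq ut).
Qed.

Lemma reach_path N s p :
  path (fun u v => v \in moves u) s p -> size p <= N -> last s p \in reach N s.
Proof.
elim/last_ind: p N => [|p t IHp] N.
  by move=> _ _; elim: N => [|N IHN]; [rewrite inE | exact: sub_expand].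
rewrite rcons_path last_rcons size_rcons => /andP[sp pt].
case: N => // N; rewrite ltnS => le_pN; apply/flatten_mapP.
by exists (last s p); [exact: IHp | rewrite inE pt orbT].
Qed.

Lemma peq_path s t : peq s t ->
  exists2 p, path (fun u v => v \in moves u) s p & t = last s p.
Proof.
elim=> [u|u v w /movesP uv _ [p vp ->]]; first by exists [::].
by exists (v :: p) => //=; rewrite uv.
Qed.

Lemma path_words m N s p :
  path (fun u v => v \in moves u) s p -> all (gtn m) s -> size s <= N ->
  {subset s :: p <= seqs_upto (iota 0 m) N}.
Proof.
elim: p s => [|t p IHp] s /= sp s_lt le_sN u; rewrite in_cons => /predU1P[-> | p_u].
- apply: mem_seqs_upto => //; apply: sub_all s_lt => i /=; by rewrite mem_iota.
- by [].
- apply: mem_seqs_upto => //; apply: sub_all s_lt => i /=; by rewrite mem_iota.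
case/andP: sp => /movesP st tp; apply: (IHp t) => //; first exact: move_all st s_lt.
by rewrite -(size_move st).
Qed.

(** The number of iterations bounds the length of a chain of moves without
    repetition, as all its words have the same length and the same letters. *)
Definition peqb m s t := t \in reach (size (seqs_upto (iota 0 m) (size s))) s.

Lemma peqbP m s t : all (gtn m) s -> reflect (peq s t) (peqb m s t).
Proof.
move=> s_lt; apply: (iffP idP) => [/reach_sound //|/peq_path[p sp ->{t}]].
case/shortenP: sp => q sq uniq_q _; apply: reach_path => //.
apply: leq_trans (leqnSn _) _; rewrite -[_.+1]/(size (s :: q)).
exact: uniq_leq_size uniq_q (path_words sq s_lt (leqnn _)).
Qed.

Definition word_eqb n (u v : word n) :=
  peqb n.-1 (pos u ++ tw n (neg v)) (pos v ++ tw n (neg u)).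

Lemma word_eqP n (u v : word n) : reflect (braid_eq u v) (word_eqb u v).
Proof.
by apply: (equivP (peqbP _ _)); [rewrite all_cat pos_all tw_all | symmetry; exact: braid_eqP].
Qed.

(** * Computability of the solution of the word problem *)

Lemma letter_code_inj n : injective (@letter_code n).
Proof.
move=> [i b] [j c]; rewrite /letter_code /= => ij.
have bc : b = c by move: (congr1 odd ij); rewrite !oddD !odd_double !addFb !oddb.
by move: ij; rewrite bc => /addIn/double_inj/val_inj ->.
Qed.

(** With this instance, the code of a word as a sequence of letters is
    [word_code]. *)
HB.instance Definition _ n := isCoded.Build (letter n) (@letter_code_inj n).

Lemma computable_letter n (B : codedType) (f : letter n -> B) : computable f.
Proof.
pose l : seq (letter n) := enum {: 'I_n.-1 * bool}.
by apply: (@computable_fin _ _ l) => x; rewrite mem_enum.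
Qed.

Lemma computable_far (A : codedType) (f g : A -> nat) :
  computable f -> computable g -> computable (fun a => far (f a) (g a)).
Proof.
by move=> compf compg; apply: computable_or; apply: computable_leq => //;
  do 2!apply: computable_succ.
Qed.

Lemma computable_adj (A : codedType) (f g : A -> nat) :
  computable f -> computable g -> computable (fun a => adj (f a) (g a)).
Proof.
by move=> compf compg; apply: computable_or; apply: computable_eq => //;
  apply: computable_succ.
Qed.

Lemma computable_root_moves : computable root_moves.
Proof.
pose tail3 (p : nat * (nat * seq nat)) k s :=
  if adj p.1 p.2.1 && (k == p.1) then [:: [:: p.2.1, p.1, p.2.1 & s]] else [::].
pose tail2 (i j : nat) s2 :=
  (if far i j then [:: [:: j, i & s2]] else [::]) ++
  (if s2 is k :: s3 then tail3 (i, (j, s2)) k s3 else [::]).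
pose tail1 (i : nat) s1 := if s1 is j :: s2 then tail2 i j s2 else [::].
apply: (computable_ext (f := fun s => if s is i :: s1 then tail1 i s1 else [::])) => //.
apply: (computable_seq_case (s := id) (g := fun _ => tail1)); try comp_proj.
apply: (computable_seq_case (s := fun p : seq nat * (nat * seq nat) => p.2.2)
  (g := fun p => tail2 p.2.1)); try comp_proj.
apply: computable_cat.
  apply: computable_if; [by apply: computable_far; comp_proj | | comp_proj].
  apply: computable_cons; last by comp_proj.
  by do 2!(apply: computable_cons; first by comp_proj); comp_proj.
apply: (computable_seq_case (s := fun p : (seq nat * (nat * seq nat)) * (nat * seq nat) => p.2.2)
  (g := fun p => tail3 (p.1.2.1, p.2))); try comp_proj.
apply: computable_if; last by comp_proj.
  by apply: computable_and; [apply: computable_adj; comp_proj | apply: computable_eq; comp_proj].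
apply: computable_cons; last by comp_proj.
by do 3!(apply: computable_cons; first by comp_proj); comp_proj.
Qed.

Lemma computable_moves : computable moves.
Proof.
(* The recursion also uses the tail itself, which is carried along. *)
pose step (_ : seq nat) i (st : seq nat * seq (seq nat)) :=
  (i :: st.1, root_moves (i :: st.1) ++ map (cons i) st.2).
apply: (computable_ext (f := fun s => (foldr (step s) ([::], [::]) s).2)).
  move=> s; suff -> : foldr (step s) ([::], [::]) s = (s, moves s) by [].
  by elim: {2 3 4}s => //= i t ->.
apply: computable_snd; apply: computable_foldr; try comp_proj.
apply: computable_pair; first by apply: computable_cons; comp_proj.
apply: computable_cat.
  apply: (computable_comp computable_root_moves).
  by apply: computable_cons; comp_proj.
apply: (computable_map (f := fun p => cons p.2.1)); last by comp_proj.
by apply: computable_cons; comp_proj.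
Qed.

Lemma computable_expand : computable expand.
Proof.
apply: computable_flatten; apply: (computable_map (f := fun _ s => s :: moves s)).
  by apply: computable_cons; [comp_proj | apply: (computable_comp computable_moves); comp_proj].
exact: computable_id.
Qed.

Lemma computable_peqb (A : codedType) m (s t : A -> seq nat) :
  computable s -> computable t -> computable (fun a => peqb m (s a) (t a)).
Proof.
move=> comps compt; apply: computable_mem => //.
apply: (computable_iter (f := fun _ => expand)).
- exact/computable_size/computable_seqs_upto/computable_size.
- by apply: (computable_comp computable_expand); comp_proj.
- by apply: computable_cons; [ | comp_proj].
Qed.

Lemma computable_pos (A : codedType) n (u : A -> word n) :
  computable u -> computable (fun a => pos (u a)).
Proof.
move=> compu; apply: computable_flatten.
apply: (computable_map (f := fun _ => @pos_letter n)) compu.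
by apply: computable_comp (computable_letter _) _; comp_proj.
Qed.

Lemma computable_tw (A : codedType) n (k : A -> nat) :
  computable k -> computable (fun a => tw n (k a)).
Proof.
move=> compk.
apply: (computable_ext (f := fun a => iter (k a) (cat (twist n.-1)) [::])).
  by move=> a; elim: (k a) => //= j ->.
apply: (computable_iter (f := fun _ => cat (twist n.-1))) => //; last by comp_proj.
by apply: computable_cat; comp_proj.
Qed.

Lemma computable_neg (A : codedType) n (u : A -> word n) :
  computable u -> computable (fun a => neg (u a)).
Proof.
move=> compu.
pose step (_ : A) (x : letter n) (k : nat) := if x.2 then k.+1 else k.
apply: (computable_ext (f := fun a => foldr (step a) 0 (u a))).
  by move=> a; elim: (u a) => //= -[i []] w ->.
apply: (computable_foldr (f := step)) compu; last by comp_proj.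
apply: computable_if; last by comp_proj.
  by apply: computable_comp (computable_letter _) _; comp_proj.
by apply: computable_succ; comp_proj.
Qed.

Lemma computable_word_eqb (A : codedType) n (u v : A -> word n) :
  computable u -> computable v -> computable (fun a => word_eqb (u a) (v a)).
Proof.
move=> compu compv; apply: computable_peqb; apply: computable_cat;
  by [apply: computable_pos | apply: computable_tw; apply: computable_neg].
Qed.

(** * The evolution of a row of cells *)

Section Cells.

Variable n : nat.
Implicit Types (c A B C : cell n) (s : seq (cell n)) (l r : option 'I_n).

Definition cell_repr c : option ('I_n * (bool * bool) + 'I_n.-1 * option bool) :=
  match c with
  | Empty => None
  | StraightLeft i => Some (inl (i, (false, false)))
  | StraightRight i => Some (inl (i, (false, true)))
  | TurnRight i => Some (inl (i, (true, false)))
  | TurnLeft i => Some (inl (i, (true, true)))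
  | TwoStraight t => Some (inr (t, None))
  | Crossing T1 t => Some (inr (t, Some false))
  | Crossing T2 t => Some (inr (t, Some true))
  end.

Definition cell_of_repr x : cell n :=
  match x with
  | None => Empty
  | Some (inl (i, (false, false))) => StraightLeft i
  | Some (inl (i, (false, true))) => StraightRight i
  | Some (inl (i, (true, false))) => TurnRight i
  | Some (inl (i, (true, true))) => TurnLeft i
  | Some (inr (t, None)) => TwoStraight t
  | Some (inr (t, Some false)) => Crossing T1 t
  | Some (inr (t, Some true)) => Crossing T2 t
  end.

Lemma cell_reprK : cancel cell_repr cell_of_repr.
Proof. by do 2?case. Qed.

HB.instance Definition _ := Finite.copy (cell n) (can_type cell_reprK).

Definition cell_enc c : nat := enum_rank c.

Lemma cell_enc_inj : injective cell_enc.
Proof. exact: inj_comp val_inj enum_rank_inj. Qed.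
HB.instance Definition _ := isCoded.Build (cell n) cell_enc_inj.

Lemma strand_right_subproof (t : 'I_n.-1) : t.+1 < n.
Proof. by case: t => t /=; lia. Qed.

Definition strand_left (t : 'I_n.-1) : 'I_n := widen_ord (leq_pred n) t.
Definition strand_right (t : 'I_n.-1) : 'I_n := Ordinal (strand_right_subproof t).

(** The number, in the next generation, of the strand leaving at the left (right)
    position.  Strands are renumbered in each generation, so that after a crossing
    the left position still has the smaller number. *)
Definition out_left c : option 'I_n :=
  match c with
  | StraightLeft i | TurnLeft i => Some i
  | TwoStraight t | Crossing _ t => Some (strand_left t)
  | _ => None
  end.

Definition out_right c : option 'I_n :=
  match c with
  | StraightRight i | TurnRight i => Some i
  | TwoStraight t | Crossing _ t => Some (strand_right t)
  | _ => None
  end.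

Definition strand_seq (o : option 'I_n) : seq nat :=
  if o is Some i then [:: val i] else [::].

Lemma strandsE c : strands c = strand_seq (out_left c) ++ strand_seq (out_right c).
Proof. by case: c. Qed.

Lemma leaves_leftE c : isSome (leaves_left c) = isSome (out_left c).
Proof. by case: c. Qed.

Lemma leaves_rightE c : isSome (leaves_right c) = isSome (out_right c).
Proof. by case: c. Qed.

Lemma strands_nil c : strands c = [::] -> c = Empty.
Proof. by case: c. Qed.

(** The value is meaningful only when two entering strands have consecutive
    numbers, as is the case in a generation. *)
Definition make_cell l r mk k : cell n :=
  match l, r with
  | None, None => Empty
  | Some i, None => if mk is Straight then StraightLeft i else TurnRight i
  | None, Some j => if mk is Straight then StraightRight j else TurnLeft j
  | Some i, Some _ =>
      if insub (val i) is Some t then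
        if mk is Straight then TwoStraight t else Crossing k t
      else Empty
  end.

Definition consec l r : Prop :=
  if l is Some i then if r is Some j then val j = i.+1 else True else True.

Variant make_cell_spec l r mk k : cell n -> Prop :=
| MakeCell c of strands c = strand_seq l ++ strand_seq r
    & enters_left c = isSome l & enters_right c = isSome r
    & (c <> Empty -> cell_mark c = Some mk)
    & (forall k' t, c = Crossing k' t -> k' = k) : make_cell_spec l r mk k c.

Lemma make_cellP l r mk k : consec l r -> make_cell_spec l r mk k (make_cell l r mk k).
Proof.
case: l r => [i|] [j|] /= eq_ji.
- have lt_i : i < n.-1 by case: j eq_ji => j /= ltj eqj; lia.
  by rewrite insubT; case: mk => /=; split=> //=; rewrite ?eq_ji // => k' t [].
- by case: mk; split.
- by case: mk; split.
- by split.
Qed.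

(** The state of a cell without its strand numbers. *)
Definition cell_shape c := (enters_left c, enters_right c, cell_mark c, cell_crossing c).

Lemma cell_shape_strands_inj c d :
  cell_shape c = cell_shape d -> strands c = strands d -> c = d.
Proof.
case: c => [|i|i|i|i|t|k t]; case: d => [|j|j|j|j|u|k' u] //= eq_sh /(congr1 (head 0)) /= eq_st;
  try discriminate eq_sh; try by rewrite (val_inj eq_st).
by case: eq_sh => ->; rewrite (val_inj eq_st).
Qed.

Lemma shape_make_cell l r mk k c :
  consec l r -> enters_left c = isSome l -> enters_right c = isSome r ->
  (c <> Empty -> cell_mark c = Some mk) ->
  (forall k' t, c = Crossing k' t -> k' = k) ->
  cell_shape c = cell_shape (make_cell l r mk k).
Proof.
case/(make_cellP mk k) => d _ <- <- d_mark d_kind c_l c_r c_mark c_kind.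
case: c d c_l c_r c_mark c_kind d_mark d_kind => [|i|i|i|i|t|k1 t] [|j|j|j|j|u|k2 u] //= _ _
  c_mark c_kind d_mark d_kind; rewrite /cell_shape //=.
all: try by move: (c_mark ltac:(discriminate)) (d_mark ltac:(discriminate)); congruence.
by rewrite (c_kind _ _ erefl) (d_kind _ _ erefl).
Qed.

End Cells.

Section Rows.

Variable n : nat.
Implicit Types (c A B C : cell n) (s : seq (cell n)) (G : generation n).

Definition numbers s : seq nat := flatten (map (@strands n) s).

(** In contrast with the cells of a generation, a row may be bordered by empty
    cells, so that it does not have to be trimmed at each step. *)
Definition valid s : Prop := numbers s = iota 0 n.

Definition row_word s : word n := flatten (map (@cell_word n) s).

(** The next row, which extends by half a cell beyond each end of [s]: its first and
    last cells have an empty parent outside of [s]. *)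
Definition step (ch : cell n -> cell n -> cell n) s := pairmap ch Empty (rcons s Empty).

Fixpoint run ch h s : word n :=
  if h is h'.+1 then row_word s ++ run ch h' (step ch s) else [::].

Lemma runS ch h s : run ch h.+1 s = row_word s ++ run ch h (step ch s).
Proof. by []. Qed.

Lemma numbers_cat s1 s2 : numbers (s1 ++ s2) = numbers s1 ++ numbers s2.
Proof. by rewrite /numbers map_cat flatten_cat. Qed.

Lemma numbers_nseq k : numbers (nseq k Empty) = [::].
Proof. by elim: k. Qed.

Lemma row_word_cat s1 s2 : row_word (s1 ++ s2) = row_word s1 ++ row_word s2.
Proof. by rewrite /row_word map_cat flatten_cat. Qed.

Lemma row_word_nseq k : row_word (nseq k Empty) = [::].
Proof. by elim: k. Qed.

Lemma iota_consec (s1 s2 : seq nat) i j a k :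
  s1 ++ [:: i, j & s2] = iota a k -> j = i.+1.
Proof.
elim: s1 a k => [|x s1 IHs] a [|k] //=; last by case=> _; exact: IHs.
by case: k => //= k [-> ->].
Qed.

Lemma numbers_consec s a k i : numbers s = iota a k ->
  consec (out_right (nth Empty s i)) (out_left (nth Empty s i.+1)).
Proof.
elim: s a k i => [|A s IHs] a k [|i] //=.
- case: s {IHs} => [|B s] /=; first by case: out_right.
  rewrite /numbers /= !strandsE; case: (out_right A) => //= x; case: (out_left B) => //= y.
  rewrite -catA /=; exact: iota_consec.
- move=> num; have : numbers s = iota (a + size (strands A)) (k - size (strands A)).
    have := congr1 (drop (size (strands A))) num.
    by rewrite /numbers /= drop_size_cat // drop_iota.
  exact: IHs.
Qed.

Section Step.

Variable ch : cell n -> cell n -> cell n.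
Hypothesis ch_empty : ch Empty Empty = Empty.

Lemma size_step s : size (step ch s) = (size s).+1.
Proof. by rewrite size_pairmap size_rcons. Qed.

Lemma nth_step s i :
  nth Empty (step ch s) i = ch (nth Empty (Empty :: s) i) (nth Empty s i).
Proof.
have [le_is|lt_si] := leqP i (size s).
  rewrite (nth_pairmap Empty) ?size_rcons // nth_rcons_default.
  congr (ch _ _); case: i le_is => //= i lt_is.
  by rewrite nth_rcons lt_is.
rewrite !nth_default ?size_step ?ch_empty //; first exact: ltnW.
Qed.

Lemma step_nseq k s1 s2 :
  step ch (s1 ++ nseq k.+1 Empty ++ s2) = step ch s1 ++ nseq k Empty ++ step ch s2.
Proof.
rewrite /step !rcons_cat pairmap_cat -[rcons s1 _]cats1
  [pairmap ch Empty (s1 ++ _ :: _)]pairmap_cat -catA /=.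
congr (_ ++ _ :: _); elim: k => //= k ->.
by rewrite ch_empty.
Qed.

(** A gap loses one empty cell in each step, so that the parts that it separates do
    not interact before it is used up. *)
Lemma run_gap h k k' s1 s2 : h <= k -> h <= k' ->
  run ch h (s1 ++ nseq k Empty ++ s2) = run ch h (s1 ++ nseq k' Empty ++ s2).
Proof.
elim: h k k' s1 s2 => // h IHh [|k] [|k'] s1 s2 // le_hk le_hk'.
rewrite !runS !row_word_cat !row_word_nseq !step_nseq.
by congr (_ ++ _); exact: IHh.
Qed.

(** A row without a long gap is bounded, as it has at most as many nonempty cells
    as strands.  The parameter [p] counts the empty cells read since the last
    nonempty one. *)
Lemma gap_or_short h p s : p <= h ->
  (exists s1 s2, nseq p Empty ++ s = s1 ++ nseq h.+1 Empty ++ s2) \/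
  p + size s <= (size (numbers s)).+1 * h.+1.
Proof.
elim: s p => [|c s IHs] p le_ph; first by right; rewrite /=; lia.
have [eq_c|c_nonempty] : c = Empty \/ 0 < size (strands c).
  by case: c; [left | right..].
  subst c; have [lt_ph|] := ltnP p h.
    have [[s1 [s2 eq_s]]|short] := IHs p.+1 lt_ph.
      by left; exists s1, s2; rewrite -eq_s -addn1 nseqD -catA.
    by right; rewrite /= -addSnnS.
  move=> le_hp; left; exists [::], s; have -> : h = p by lia.
  by rewrite -addn1 nseqD -catA.
have [[s1 [s2 eq_s]]|short] := IHs 0 (leq0n h).
  left; exists (nseq p Empty ++ c :: s1), s2.
  by rewrite -catA /= -eq_s.
right; rewrite /= /numbers /= size_cat.
move: short; rewrite add0n; set x := size (flatten _).
move: c_nonempty; nia.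
Qed.

Lemma short_row h s : exists2 s',
  size s' <= (size (numbers s)).+1 * h.+1 &
  numbers s' = numbers s /\ run ch h s' = run ch h s.
Proof.
have [N] := ubnP (size s); elim: N s => // N IHN s lt_sN.
have [[s1 [s2 eq_s]]|] := gap_or_short s (leq0n h); last by exists s.
rewrite [LHS]/= in eq_s.
have [|s' size_s' [num_s' run_s']] := IHN (s1 ++ nseq h Empty ++ s2).
  by move: lt_sN; rewrite eq_s !size_cat !size_nseq; lia.
have num_s : numbers (s1 ++ nseq h Empty ++ s2) = numbers s.
  by rewrite eq_s !numbers_cat !numbers_nseq.
exists s'; rewrite -?num_s //; split=> //.
by rewrite run_s' eq_s; exact: run_gap.
Qed.

End Step.

Section Child.

Variables (tau : option turn_mark -> option turn_mark -> turn_mark)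
  (kappa : option crossing_kind -> option crossing_kind -> crossing_kind).

Definition child A B : cell n :=
  make_cell (out_right A) (out_left B) (tau (leaves_right A) (leaves_left B))
    (kappa (cell_crossing A) (cell_crossing B)).

(** Each strand of a row leaves its cell for exactly one child, and the order of the
    numbers is kept: the strands leaving at the right of a cell come just before
    those leaving at the left of the next one. *)
Lemma step_valid s : valid s -> valid (step child s).
Proof.
rewrite /valid => valid_s; rewrite -[RHS]valid_s.
suff numE A a k : numbers (A :: s) = iota a k ->
    numbers (pairmap child A (rcons s Empty)) = strand_seq (out_right A) ++ numbers s.
  exact: (numE Empty) valid_s.
elim: {valid_s} s A a k => [|B s IHs] A a k num_As.
  rewrite /numbers /= cats0 /child /=.
  have consec_A : consec (out_right A) None by case: out_right.
  by case: (make_cellP _ _ consec_A) => c -> _ _ _ _; rewrite !cats0.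
have consec_AB := numbers_consec 0 num_As.
rewrite /numbers /= -/(numbers _).
have -> : numbers (pairmap child B (rcons s Empty)) = strand_seq (out_right B) ++ numbers s.
  have := congr1 (drop (size (strands A))) num_As.
  rewrite {1}/numbers /= drop_size_cat // drop_iota; exact: IHs.
rewrite /child; case: (make_cellP _ _ consec_AB) => c -> _ _ _ _.
by rewrite -!catA strandsE -catA.
Qed.

End Child.

End Rows.

(** * Generations as trimmed rows *)

Section Patterns.

Variable n : nat.
Implicit Types (c A B C : cell n) (s : seq (cell n)) (G : generation n) (i j a : int).

(** The index counts cells, not positions. *)
Definition row_at s i : cell n := if i is Posz k then nth Empty s k else Empty.

Lemma cell_atE G i : cell_at G (start G + i * 2)%R = row_at (cells G) i.
Proof.
rewrite /cell_at /row_at; case: i => k.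
  rewrite ifT; last by lia.
  by congr (nth _ _ _); lia.
by rewrite ifF //; lia.
Qed.

Lemma row_at_pad s p q i :
  row_at (nseq p Empty ++ s ++ nseq q Empty) (Posz p + i)%R = row_at s i.
Proof.
have nth_r k : nth Empty (s ++ nseq q Empty) k = nth Empty s k.
  rewrite nth_cat; case: ltnP => // le_sk.
  by rewrite nth_nseq if_same nth_default.
case: i => k /=.
  by rewrite nth_cat size_nseq ifF ?addKn ?nth_r //; lia.
case eq_i: (Posz p + Negz k)%R => [l|//] /=.
rewrite nth_cat size_nseq ifT; last by lia.
by rewrite nth_nseq if_same.
Qed.

(** The row [s], placed at position [a], is the generation [G] up to empty borders. *)
Definition shows a s G : Prop := exists p q,
  s = nseq p Empty ++ cells G ++ nseq q Empty /\ start G = (a + p%:Z * 2)%R.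

Lemma shows_at a s G i : shows a s G -> cell_at G (a + i * 2)%R = row_at s i.
Proof.
case=> p [q [-> start_G]].
have -> : (a + i * 2 = start G + (i - p%:Z) * 2)%R by rewrite start_G; lia.
rewrite cell_atE -(row_at_pad _ p q); congr row_at; lia.
Qed.

Lemma shows_valid a s G : shows a s G -> valid s.
Proof.
case=> p [q [-> _]]; rewrite /valid !numbers_cat !numbers_nseq cats0.
by case: G.
Qed.

Lemma shows_word a s G : shows a s G -> row_word s = row_word (cells G).
Proof. by case=> p [q [-> _]]; rewrite !row_word_cat !row_word_nseq cats0. Qed.

Lemma shows_mod a s G i : shows a s G ->
  (i = start G %[mod 2])%Z <-> exists k, i = (a + k * 2)%R.
Proof.
case=> p [q [_ ->]]; split=> [eq_mod|[k ->]].
  exists ((i - a) %/ 2)%Z; lia.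
lia.
Qed.

Lemma strip_left s : exists p s',
  s = nseq p Empty ++ s' /\ (s' = [::] \/ strands (head Empty s') <> [::]).
Proof.
elim: s => [|c s [p [s' [-> IHs]]]]; first by exists 0, [::]; split=> //; left.
case: (boolP (c == Empty)) => [/eqP->|/eqP c_nonempty].
  by exists p.+1, s'.
exists 0, (c :: nseq p Empty ++ s'); split=> //; right=> /= /strands_nil.
exact: c_nonempty.
Qed.

Lemma strip_right s : exists q s',
  s = s' ++ nseq q Empty /\ (s' = [::] \/ strands (last Empty s') <> [::]).
Proof.
elim/last_ind: s => [|s c [q [s' [-> IHs]]]]; first by exists 0, [::]; split=> //; left.
case: (boolP (c == Empty)) => [/eqP->|/eqP c_nonempty].
  by exists q.+1, s'; rewrite rcons_cat -cats1 -[q.+1]addn1 nseqD.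
exists 0, (rcons (s' ++ nseq q Empty) c); rewrite cats0; split=> //; right.
by rewrite last_rcons => /strands_nil.
Qed.

(** Trimming, which needs a strand to stop at: without strands there would be no
    first and last cell. *)
Lemma shows_exists a s : 0 < n -> valid s -> exists G, shows a s G.
Proof.
move=> n_gt0; rewrite /valid.
have [p [s1 [-> head_s1]]] := strip_left s.
have [q [t [eq_s1 last_t]]] := strip_right s1.
subst s1; rewrite !numbers_cat !numbers_nseq cats0 /= => num_t.
have t_nonempty : t <> [::] by move=> t0; move/(congr1 size): num_t; rewrite t0 size_iota /=; lia.
have head_t : 0 \in strands (head Empty t).
  case: head_s1 => [|]; first by case: (t) t_nonempty.
  case: t {last_t} num_t t_nonempty => //= c t; rewrite /numbers /=.
  have -> : iota 0 n = 0 :: iota 1 n.-1 by rewrite -{1}(prednK n_gt0).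
  by case: (strands c) => //= x l [-> _] _ _; rewrite inE eqxx.
have last_t' : n.-1 \in strands (last Empty t).
  case: last_t => // nonempty.
  case/lastP: t {head_t head_s1} num_t t_nonempty nonempty => // t c.
  rewrite last_rcons -cats1 numbers_cat /numbers /= cats0 => num_t _.
  have last_iota : last 0 (iota 0 n) = n.-1.
    by rewrite -{1}(prednK n_gt0) -[n.-1.+1]addn1 iotaD last_cat.
  rewrite -last_iota -num_t last_cat; case: (strands c) => //= x l _.
  exact: mem_last.
by exists (@Generation _ (a + p%:Z * 2)%R t num_t head_t last_t'), p, q.
Qed.

(** Continuity and the two rules are conditions on consecutive generations, here
    gathered for one such pair. *)
Definition follows tau kappa G G' : Prop :=
  (start G' = start G + 1 %[mod 2])%Z /\
  forall j, (j = start G %[mod 2])%Z ->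
    let A := cell_at G j in let B := cell_at G (j + 2)%R in
    let C := cell_at G' (j + 1)%R in
    [/\ enters_left C = isSome (out_right A), enters_right C = isSome (out_left B),
        C <> Empty -> cell_mark C = Some (tau (leaves_right A) (leaves_left B))
      & forall k t, C = Crossing k t -> k = kappa (cell_crossing A) (cell_crossing B)].

Lemma SCA_patternP (g : pattern n) : SCA_pattern g <->
  exists tau kappa, forall G G', consecutive g G G' -> follows tau kappa G G'.
Proof.
have iff_isSome (T : Type) (b : bool) (x : option T) : b = isSome x <-> (b <-> x <> None).
  split=> [->|[b_x x_b]]; first by case: x; split.
  by case: x b_x x_b => [x|] b_x x_b; [exact: x_b | apply/negP=> /b_x].
split=> [[[par cont] [tau tauP] [kappa kappaP]] | [tau [kappa folP]]].
  exists tau, kappa => G G' GG'; split; first exact: par.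
  move=> j j_mod A B C; have chC : child_of g A B C by exists G, G', j.
  have [lC rC] := cont _ _ _ chC; split.
  - by rewrite -leaves_rightE; apply/iff_isSome.
  - by rewrite -leaves_leftE; apply/iff_isSome.
  - exact: tauP.
  - by move=> k t eq_C; apply: (kappaP _ _ _ t); rewrite -eq_C.
have child_follows A B C : child_of g A B C ->
    [/\ enters_left C = isSome (out_right A), enters_right C = isSome (out_left B),
        C <> Empty -> cell_mark C = Some (tau (leaves_right A) (leaves_left B))
      & forall k t, C = Crossing k t -> k = kappa (cell_crossing A) (cell_crossing B)].
  by case=> G [G' [j [GG' j_mod -> -> ->]]]; have [_ /(_ j j_mod)] := folP _ _ GG'.
split.
- split=> [G G' /folP[] // | A B C /child_follows[lC rC _ _]].
  by split; apply/iff_isSome; rewrite ?leaves_rightE ?leaves_leftE.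
- by exists tau => A B C /child_follows[].
- by exists kappa => A B k t /child_follows[_ _ _ /(_ k t erefl)].
Qed.

Section Rules.

Variables (tau : option turn_mark -> option turn_mark -> turn_mark)
  (kappa : option crossing_kind -> option crossing_kind -> crossing_kind).

Local Notation ch := (@child n tau kappa).

Lemma row_at_step s i : row_at (step ch s) (i + 1)%R = ch (row_at s i) (row_at s (i + 1)%R).
Proof.
case: i => [k|[|k]].
- by rewrite -PoszD addn1 /= nth_step.
- by rewrite /= nth_step.
by have -> : (Negz k.+1 + 1 = Negz k)%R by lia.
Qed.

Lemma row_at_consec s i : valid s ->
  consec (out_right (row_at s i)) (out_left (row_at s (i + 1)%R)).
Proof.
move=> valid_s; case: i => [k|[|k]] //.
by rewrite -PoszD addn1 /=; exact: numbers_consec valid_s.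
Qed.

Lemma shows_follows a s G G' :
  shows a s G -> shows (a - 1)%R (step ch s) G' -> follows tau kappa G G'.
Proof.
move=> sG sG'; split.
  by case: sG sG' => p [q [_ ->]] [p' [q' [_ ->]]]; lia.
move=> j /(shows_mod j sG)[i ->] /=.
have -> : (a + i * 2 + 2 = a + (i + 1) * 2)%R by lia.
have -> : (a + i * 2 + 1 = (a - 1) + (i + 1) * 2)%R by lia.
rewrite !(shows_at _ sG) (shows_at _ sG') row_at_step /child.
have := row_at_consec i (shows_valid sG).
by move=> /(make_cellP (tau _ _) (kappa _ _))[].
Qed.

Lemma eq_rows s s' :
  map (@cell_shape n) s = map (@cell_shape n) s' -> numbers s = numbers s' -> s = s'.
Proof.
elim: s s' => [|c s IHs] [|c' s'] //= [] c_l c_r c_mark c_kind /IHs eq_s.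
rewrite /numbers /= => num_eq.
have size_c : size (strands c) = size (strands c').
  by case: (c) (c') c_l c_r => [|?|?|?|?|?|? ?] [|?|?|?|?|?|? ?].
move/eqP: num_eq; rewrite eqseq_cat // => /andP[/eqP eq_c /eqP/eq_s ->].
by congr (_ :: _); apply: cell_shape_strands_inj eq_c; rewrite /cell_shape c_l c_r c_mark c_kind.
Qed.

(** Continuity and the rules determine the shape of every cell of the next
    generation; the strand numbers are then forced as they increase by one from
    left to right. *)
Lemma follows_shows a s G G' :
  shows a s G -> follows tau kappa G G' -> shows (a - 1)%R (step ch s) G'.
Proof.
move=> sG [par_G' folG].
have valid_s := shows_valid sG.
(* The first cell of [G'] has index [e] in the row [step ch s]; both it and the
   last cell of [G'] are nonempty, hence lie within this row. *)
have [e eq_e] : exists e, start G' = ((a - 1) + e * 2)%R.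
  exists ((start G' - (a - 1)) %/ 2)%Z.
  by case: sG => p [q [_ eq_G]]; rewrite eq_G in par_G'; lia.
have shape_at i : cell_shape (cell_at G' ((a - 1) + (i + 1) * 2)%R) =
    cell_shape (row_at (step ch s) (i + 1)%R).
  rewrite row_at_step.
  have /folG : (a + i * 2 = start G %[mod 2])%Z by apply/(shows_mod _ sG); exists i.
  have -> : (a + i * 2 + 2 = a + (i + 1) * 2)%R by lia.
  have -> : (a + i * 2 + 1 = (a - 1) + (i + 1) * 2)%R by lia.
  rewrite !(shows_at _ sG) => -[C_l C_r C_mark C_kind].
  by apply: shape_make_cell => //; exact: row_at_consec.
have shapeE i : cell_shape (row_at (cells G') (i - e)) = cell_shape (row_at (step ch s) i).
  rewrite -cell_atE eq_e.
  have -> : (a - 1 + e * 2 + (i - e) * 2 = (a - 1) + (i - 1 + 1) * 2)%R by lia.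
  by rewrite shape_at; congr (cell_shape (row_at _ _)); lia.
have shape_empty C : cell_shape C = cell_shape (@Empty n) -> C = Empty by case: C.
have size_gt0 : 0 < size (cells G').
  by case: (G') => st [|c l] //= _; rewrite in_nil.
have e_ge0 : (0 <= e)%R.
  have := shapeE e; rewrite GRing.subrr; case: (e) => // k /shape_empty /=.
  by rewrite nth0; case: (G') => st l /= _ + _; case: head.
case: e e_ge0 eq_e shapeE => // p _ eq_e shapeE.
have le_size : p + size (cells G') <= size (step ch s).
  rewrite leqNgt; apply/negP => gt_size.
  have := shapeE (Posz (p + (size (cells G')).-1)).
  have -> : (Posz (p + (size (cells G')).-1) - Posz p = Posz (size (cells G')).-1)%R by lia.
  rewrite [row_at (step _ _) _]/= [nth _ (step _ _) _]nth_default; last by lia.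
  move/shape_empty => /=; rewrite nth_last.
  by case: (G') => st l /= _ _ +; case: last.
pose q := size (step ch s) - (p + size (cells G')).
exists p, q; split=> //; apply: eq_rows; last first.
  rewrite (step_valid tau kappa valid_s) !numbers_cat !numbers_nseq cats0.
  by case: (G').
apply: (@eq_from_nth _ (cell_shape (@Empty n))).
  by rewrite !size_map !size_cat !size_nseq /q; lia.
move=> i; rewrite size_map => lt_i.
rewrite !(nth_map Empty) //; last first.
  by rewrite !size_cat !size_nseq /q; lia.
rewrite -[nth _ (step _ _) _]/(row_at (step ch s) i) -shapeE.
rewrite -[nth _ _ _]/(row_at (nseq p Empty ++ cells G' ++ nseq q Empty) i).
by rewrite -(row_at_pad _ p q); congr (cell_shape (row_at _ _)); lia.
Qed.

Lemma pattern_word_run a s G (g : pattern n) :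
  shows a s G -> (forall G1 G2, consecutive (G :: g) G1 G2 -> follows tau kappa G1 G2) ->
  pattern_word (G :: g) = run ch (size g).+1 s.
Proof.
elim: g a s G => [|G' g IHg] a s G sG folP.
  by rewrite runS (shows_word sG).
have sG' : shows (a - 1)%R (step ch s) G'.
  by apply: follows_shows sG (folP _ _ _); exists [::], g.
rewrite runS (shows_word sG) -(IHg _ _ _ sG') //.
by move=> G1 G2 [g1 [g2 eq_g]]; apply: folP; exists (G :: g1), g2; rewrite eq_g.
Qed.

Lemma run_pattern h a s : 0 < n -> valid s -> exists g : pattern n,
  [/\ size g = h, pattern_word g = run ch h s,
      forall G1 G2, consecutive g G1 G2 -> follows tau kappa G1 G2
    & if g is G :: _ then shows a s G else True].
Proof.
move=> n_gt0; elim: h a s => [|h IHh] a s valid_s.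
  by exists [::]; split=> // G1 G2 [[|? ?] [g2]].
have [G sG] := shows_exists a n_gt0 valid_s.
have [g [size_g word_g folP sg]] := IHh (a - 1)%R _ (step_valid tau kappa valid_s).
exists (G :: g); split=> //=; first by rewrite size_g.
  by rewrite (shows_word sG) -word_g.
move=> G1 G2 [[|G0 g1] [g2 /= [eq_G eq_g]]]; last by apply: folP; exists g1, g2.
by subst G1 g; exact: shows_follows sG sg.
Qed.

End Rules.

(** An SCA pattern is recovered from its first row and its rules; conversely the
    successive rows of an evolution, once trimmed, form an SCA pattern. *)
Lemma SCA_representationP h (w : word n) : 0 < n -> 0 < h ->
  (exists g, SCA_representation (braid_class w) g /\ height g = h) <->
  exists tau kappa s, valid s /\ braid_eq (run (@child n tau kappa) h s) w.
Proof.
move=> n_gt0 h_gt0; split=> [[g [[/SCA_patternP[tau [kappa folP]]]]] |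
    [tau [kappa [s [valid_s eq_w]]]]].
  move=> /braid_classP eq_w size_g; exists tau, kappa.
  case: g folP eq_w size_g => [|G g] folP eq_w size_g; first by rewrite -size_g in h_gt0.
  have sG : shows (start G) (cells G) G.
    by exists 0, 0; rewrite cats0; split=> //; lia.
  exists (cells G); split; first exact: shows_valid sG.
  by rewrite -size_g -[height _]/(size g).+1 -(pattern_word_run sG folP).
have [g [size_g word_g folP _]] := run_pattern tau kappa h 0%R n_gt0 valid_s.
exists g; split=> //; split; first by apply/SCA_patternP; exists tau, kappa.
by apply/braid_classP; rewrite word_g.
Qed.

End Patterns.

(** * The decision procedure *)

Lemma computable_muln_const (T : codedType) k (f : T -> nat) :
  computable f -> computable (fun a => k * f a).
Proof.
move=> compf; elim: k => [|k IHk]; first exact: computable_const.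
apply: (computable_ext (f := fun a => f a + k * f a)) => [a|].
  by rewrite mulSn.
exact: computable_nat2 rec2_addn compf IHk.
Qed.

Section Decision.

Variable n : nat.
Implicit Types (T : codedType) (ch : cell n -> cell n -> cell n).

Lemma computable_cell T (f : cell n -> T) : computable f.
Proof. by apply: (@computable_fin (cell n) _ (enum {: cell n})) => c; rewrite mem_enum. Qed.

Lemma computable_cell2 T ch (A B : T -> cell n) :
  computable A -> computable B -> computable (fun a => ch (A a) (B a)).
Proof.
apply: (computable_comp2 (h := ch)).
pose l : seq (cell n * cell n) := enum {: cell n * cell n}.
by apply: (@computable_fin (cell n * cell n)%type _ l) => p; rewrite mem_enum.
Qed.

Lemma computable_step T ch (s : T -> seq (cell n)) :
  computable s -> computable (fun a => step ch (s a)).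
Proof.
move=> comps.
(* Read from the right, the state consists of the last cell read and the children
   found so far. *)
pose next (_ : T) A (st : cell n * seq (cell n)) := (A, ch A st.1 :: st.2).
apply: (computable_ext (f := fun a => (foldr (next a) (Empty, [::]) (Empty :: s a)).2)).
  move=> a; suff foldrE A l :
      (foldr (next a) (Empty, [::]) (A :: l)).2 = pairmap ch A (rcons l Empty) by [].
  by elim: l A => //= B l IHl A; rewrite -IHl.
apply/computable_snd/computable_foldr; first 2 last.
- by apply: computable_cons; first exact: computable_const.
- apply: computable_pair; first by comp_proj.
  by apply: computable_cons; [apply: computable_cell2; comp_proj | comp_proj].
- exact: computable_const.
Qed.

Lemma computable_row_word T (s : T -> seq (cell n)) :
  computable s -> computable (fun a => row_word (s a)).
Proof.
move=> comps; apply: computable_flatten.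
apply: (computable_map (f := fun _ => @cell_word n)) comps.
by apply: computable_comp (computable_cell _) _; comp_proj.
Qed.

Lemma computable_numbers T (s : T -> seq (cell n)) :
  computable s -> computable (fun a => numbers (s a)).
Proof.
move=> comps; apply: computable_flatten.
apply: (computable_map (f := fun _ => @strands n)) comps.
by apply: computable_comp (computable_cell _) _; comp_proj.
Qed.

Lemma computable_run T ch (h : T -> nat) (s : T -> seq (cell n)) :
  computable h -> computable s -> computable (fun a => run ch (h a) (s a)).
Proof.
move=> comph comps.
pose next (_ : T) (st : seq (cell n) * word n) := (step ch st.1, st.2 ++ row_word st.1).
apply: (computable_ext (f := fun a => (iter (h a) (next a) (s a, [::])).2)).
  move=> a; rewrite -[RHS]cat0s; elim: (h a) (s a) [::] => [|k IHk] r w.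
    by rewrite cats0.
  by rewrite iterSr IHk -catA.
apply/computable_snd/computable_iter => //.
  apply: computable_pair; first by apply: computable_step; comp_proj.
  by apply: computable_cat; [comp_proj | apply: computable_row_word; comp_proj].
by apply: computable_pair; first 1 last; [exact: computable_const |].
Qed.

(** By [short_row], these rows represent all first rows with [n] strands. *)
Definition rows_of_height h : seq (seq (cell n)) := seqs_upto (enum {: cell n}) (n.+1 * h.+1).

Definition represented ch (x : nat * word n) : bool :=
  has (fun s => (numbers s == iota 0 n) && word_eqb (run ch x.1 s) x.2)
      (rows_of_height x.1).

Lemma computable_represented ch : computable (represented ch).
Proof.
apply: (computable_has
  (f := fun x s => (numbers s == iota 0 n) && word_eqb (run ch x.1 s) x.2)).
  apply: computable_and.
    by apply: computable_eq; [apply: computable_numbers; comp_proj | exact: computable_const].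
  by apply: computable_word_eqb; [apply: computable_run; comp_proj | comp_proj].
apply/computable_seqs_upto/computable_muln_const/computable_succ; comp_proj.
Qed.

(** All the effects of rules on pairs of cells.  This is a constant of the procedure,
    so that a classical choice of its members does no harm to computability. *)
Definition child_tables : seq {ffun cell n * cell n -> cell n} :=
  [seq ch : {ffun cell n * cell n -> cell n} <-
       enum {: {ffun cell n * cell n -> cell n}} |
    `[< exists tau kappa, forall A B, ch (A, B) = child tau kappa A B >]].

Definition representable (x : nat * word n) : bool :=
  has (fun ch : {ffun cell n * cell n -> cell n} => represented (fun A B => ch (A, B)) x)
      child_tables.

Lemma computable_representable : computable representable.
Proof. by apply: computable_has_const => ch; exact: computable_represented. Qed.

Lemma representableP h (w : word n) : 0 < n -> 0 < h ->
  representable (h, w) <->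
  exists g, SCA_representation (braid_class w) g /\ height g = h.
Proof.
move=> n_gt0 h_gt0; rewrite SCA_representationP //; split.
  case/hasP=> ch; rewrite mem_filter => /andP[/asboolP[tau [kappa eq_ch]] _].
  case/hasP=> s _ /= /andP[/eqP valid_s /word_eqP eq_w].
  exists tau, kappa, s; split=> //.
  by rewrite (_ : @child n tau kappa = fun A B => ch (A, B)) //;
    apply/funext => A; apply/funext => B.
move=> [tau [kappa [s [valid_s eq_w]]]].
pose ch := [ffun p : cell n * cell n => child tau kappa p.1 p.2].
apply/hasP; exists ch.
  rewrite mem_filter mem_enum andbT; apply/asboolP; exists tau, kappa => A B.
  by rewrite ffunE.
have -> : (fun A B => ch (A, B)) = @child n tau kappa.
  by apply/funext => A; apply/funext => B; rewrite ffunE.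
have [|s' size_s' [num_s' run_s']] := short_row (ch := child tau kappa) _ h s.
  by [].
apply/hasP; exists s'.
  apply: mem_seqs_upto; first by apply/allP => c _; rewrite mem_enum.
  by rewrite valid_s size_iota in size_s'.
by rewrite num_s' valid_s eqxx /= run_s'; apply/word_eqP.
Qed.

End Decision.

Theorem theorem3p9 (n : nat) (n_gt0 : 0 < n) :
  recursively_decidable (@instance_code n)
    (fun x : instance n =>
       exists g : pattern n,
         SCA_representation (braid_class x.2) g /\ height g = sval x.1).
Proof.
have [F recF FE] := computable_representable n.
exists (fun v => F (code_pair (tnth v ord0) (tnth v (inord 1)))).
  apply: (recursive_app1 recF).
  by apply: (recursive_app2 rec2_code_pair); exact: rec_proj.
move=> [[h h_gt0] w].
have -> : F (code_pair (tnth (instance_code (exist _ h h_gt0, w)) ord0)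
    (tnth (instance_code (exist _ h h_gt0, w)) (inord 1))) = representable (h, w).
  by rewrite -[RHS]/(enc (representable (h, w))) -FE !(tnth_nth 0) inordK.
rewrite -(representableP w n_gt0 h_gt0) /=.
by split=> [->|/negP/negbTE->].
Qed.
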